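(* For every non-empty set $X$, the free left $h$-Ehresmann semigroup on $X$ is exactly the $(2,1)$-algebra $\mathrm{H}(X)\setminus\{\varepsilon\}$ (with $X\subseteq \mathrm{H}(X)\setminus\{\varepsilon\}$ as free generating set).
   Context: **Left $h$-Ehresmann semigroups.** A semigroup $S$ with a unary operation ${}^+$ is left Ehresmann if $x^+x=x$, $(x^+y^+)^+=x^+y^+=y^+x^+$ and $(xy)^+=(xy^+)^+$ for all $x,y\in S$; it is left $h$-Ehresmann if moreover $(xz^+y)^+=(xy)^+(xz)^+$ for all $x,y,z\in S$. These are regarded as $(2,1)$-algebras (product, ${}^+$). The free left $h$-Ehresmann semigroup on $X$ is the left $h$-Ehresmann semigroup $F$ containing $X$ such that for every left $h$-Ehresmann semigroup $S$ every function $X\to S$ extends to a unique $(2,1)$-morphism $F\to S$. **Left $X$-trees.** Let $X$ be a non-empty set. A left $X$-tree is a finite directed tree (a finite directed graph whose underlying undirected graph is a tree), with edges labelled by elements of $X$, and two distinguished (possibly equal) vertices, start and end, such that every vertex is reachable by a directed path from the start vertex. Its trunk is the directed path from start to end. Morphisms are directed graph morphisms preserving labels, start and end. Left $X$-trees are considered up to isomorphism; $\mathrm{LUT}^1(X)$ is the set of all of them, $\mathcal{E}(X)$ the subset of those with start $=$ end, and $\varepsilon$ the one-vertex tree. Each $x\in X$ is identified with the tree consisting of a single edge labelled $x$ from the start vertex to the (distinct) end vertex. The gluing product $\Gamma\times\Delta$ is obtained by identifying the end vertex of $\Gamma$ with the start vertex of $\Delta$; its start is that of $\Gamma$ and its end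 is that of $\Delta$. The tree $\Gamma^{(+)}$ is $\Gamma$ with the end vertex relocated to the start vertex. **Pruning.** A retraction on $\Gamma$ is a morphism $\phi:\Gamma\to\Gamma$ with $\phi\circ\phi=\phi$. A tree is pruned if its only retraction is the identity. It is known (Kambites) that each $\Gamma$ has a unique pruned left $X$-tree $\overline{\Gamma}$ which is the image of a retraction on $\Gamma$. **Splaying.** A leaf is a vertex that is not the initial vertex of any edge. For $B\in\mathcal{E}(X)$ and a vertex $v$, let $p_v\in\mathcal{E}(X)$ be the directed path from the start vertex of $B$ to $v$, with start and end both located at the start vertex of $B$. Put $\mathrm{Splay}(B)=\prod_{v \text{ a leaf of } B} p_v$ (gluing product, commutative on $\mathcal{E}(X)$). Each $\Gamma\in\mathrm{LUT}^1(X)$ has a unique branch decomposition $\Gamma=B_0\times x_1\times B_1\times\cdots\times x_k\times B_k$ with $x_i\in X$ the trunk labels and $B_i\in\mathcal{E}(X)$; put $\mathrm{Splay}(\Gamma)=\mathrm{Splay}(B_0)\times x_1\times\mathrm{Splay}(B_1)\times\cdots\times x_k\times\mathrm{Splay}(B_k)$. **The algebra $\mathrm{H}(X)$.** Put $\widehat{\Gamma}=\overline{\mathrm{Splay}(\Gamma)}$ and $\mathrm{H}(X)=\{\widehat{\Gamma} : \Gamma\in\mathrm{LUT}^1(X)\}$, with operations $\Gamma\Delta:=\widehat{\Gamma\times\Delta}$, $\Gamma^+:=\widehat{\Gamma^{(+)}}$ and distinguished element $\varepsilon$. The $(2,1)$-algebra $\mathrm{H}(X)\setminus\{\varepsilon\}$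 has the restricted product and ${}^+$. *)

(* Defs.v *)
From HB Require Import structures.
From mathcomp Require Import all_boot.
From mathcomp Require Import boolp classical_sets.

Set Implicit Arguments.
Unset Strict Implicit.
Unset Printing Implicit Defensive.

Local Open Scope quotient_scope.
Local Open Scope classical_set_scope.

(** * Left h-Ehresmann semigroups *)

Record algebra21 := Algebra21 {
  carrier :> Type;
  amul : carrier -> carrier -> carrier;
  aplus : carrier -> carrier }.

Definition left_Ehresmann (S : algebra21) : Prop :=
  let mul := @amul S in let plus := @aplus S in
  [/\ forall x y z, mul x (mul y z) = mul (mul x y) z,
      forall x, mul (plus x) x = x,
      forall x y, plus (mul (plus x) (plus y)) = mul (plus x) (plus y),
      forall x y, mul (plus x) (plus y) = mul (plus y) (plus x) &
      forall x y, plus (mul x y) = plus (mul x (plus y))].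

Definition left_h_Ehresmann (S : algebra21) : Prop :=
  let mul := @amul S in let plus := @aplus S in
  left_Ehresmann S /\
  forall x y z,
    plus (mul (mul x (plus z)) y) = mul (plus (mul x y)) (plus (mul x z)).

Definition morphism21 (S T : algebra21) (f : S -> T) : Prop :=
  (forall x y, f (amul x y) = amul (f x) (f y)) /\
  (forall x, f (aplus x) = aplus (f x)).

Definition free_left_h_Ehresmann (X : Type) (F : algebra21) (iota : X -> F) :
    Prop :=
  [/\ left_h_Ehresmann F,
      injective iota &
      forall S : algebra21, left_h_Ehresmann S -> forall f : X -> S,
        exists! g : F -> S, morphism21 g /\ forall x, g (iota x) = f x].

(** * Left X-trees *)

(* Labelled directed graphs with a start and an end vertex.  There is at most
   one edge from one vertex to another, which is no restriction for trees. *)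
Record pgraph (X : Type) (V : finType) := PGraph {
  edge : V -> V -> option X;
  start : V;
  stop : V }.

Section Graphs.
Context (X : Type) (V : finType).
Implicit Type G : pgraph X V.

Definition arc G : rel V := fun u v => edge G u v.

Definition uarc G : rel V := fun u v => arc G u v || arc G v u.

(* Loops and pairs of antiparallel edges are cycles of length 1 and 2 of the
   underlying undirected graph, which [uarc] does not see; any other cycle has
   at least three vertices. *)
Definition underlying_tree G : Prop :=
  [/\ forall u v, connect (uarc G) u v,
      forall u v, arc G u v -> ~~ arc G v u &
      forall p : seq V, ucycle (uarc G) p -> size p <= 2].

Definition is_left_tree G : Prop :=
  underlying_tree G /\ forall v, connect (arc G) (start G) v.

Definition is_leaf G (v : V) : bool := [forall w, ~~ arc G v w].

End Graphs.

Definition gmorphism (X : Type) (V W : finType) (G : pgraph X V)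
    (D : pgraph X W) (f : V -> W) : Prop :=
  [/\ f (start G) = start D, f (stop G) = stop D &
      forall u v x, edge G u v = Some x -> edge D (f u) (f v) = Some x].

Definition giso (X : Type) (V W : finType) (G : pgraph X V) (D : pgraph X W) :
    Prop :=
  exists (f : V -> W) (g : W -> V),
    [/\ gmorphism G D f, gmorphism D G g, cancel f g & cancel g f].

Section Arborescence.
Context (X : Type) (V : finType).
Implicit Type G : pgraph X V.

Lemma connect_homo (W : finType) (e : rel V) (e' : rel W) (f : V -> W) :
  (forall u v, e u v -> connect e' (f u) (f v)) ->
  forall u v, connect e u v -> connect e' (f u) (f v).
Proof.
move=> h u v /connectP[p]; elim: p u => [|w p IH] u /=.
  by move=> _ ->.
by case/andP=> /h uw pw /(IH _ pw); apply: connect_trans.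
Qed.

Lemma uarc_sym G : symmetric (uarc G).
Proof. by move=> u v; rewrite /uarc orbC. Qed.

Lemma arc_uarc G : subrel (arc G) (uarc G).
Proof. by move=> u v; rewrite /uarc => ->. Qed.

Lemma connect_arc_last (e : rel V) u v :
  connect e u v -> u != v -> exists2 w, connect e u w & e w v.
Proof.
case/connectP=> p; elim/last_ind: p => [|p w _] /=.
  by move=> _ ->; rewrite eqxx.
rewrite rcons_path last_rcons => /andP[pp pw] -> _.
by exists (last u p) => //; apply/connectP; exists p.
Qed.

Lemma connect_upath (e : rel V) u v : connect e u v ->
  exists p, [/\ path e u p, uniq (u :: p) & v = last u p].
Proof.
case/connectP=> p pp ->; case/shortenP: pp => p' pp' up' _.
by exists p'.
Qed.

Lemma left_tree_acyclic G u v :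
  is_left_tree G -> arc G u v -> ~~ connect (arc G) v u.
Proof.
case=> [[_ asym cyc] _] uv; apply/negP => /connect_upath[p [pp up lp]].
have uc : ucycle (uarc G) (v :: p).
  rewrite /ucycle up andbT /= rcons_path (sub_path (@arc_uarc G)) //=.
  by rewrite -lp arc_uarc.
have := cyc _ uc; case: p pp up lp uc => [|w [|//]] /=.
  by move=> _ _ eu; move: (uv) (asym _ _ uv); rewrite eu => ->.
by rewrite andbT => vw _ eu _ _; move: (vw) (asym _ _ uv); rewrite eu => ->.
Qed.

Lemma left_tree_start G u : is_left_tree G -> ~~ arc G u (start G).
Proof. by move=> tG; apply/negP => /(left_tree_acyclic tG); case: tG => _ ->. Qed.

Lemma left_tree_parent G u u' v :
  is_left_tree G -> arc G u v -> arc G u' v -> u = u'.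
Proof.
move=> tG uv u'v; apply/eqP/negP => /negP neq.
have [[_ _ cyc] reach] := tG.
pose e := [rel x y | [&& uarc G x y, x != v & y != v]].
have esym : symmetric e.
  by move=> x y; rewrite /= uarc_sym; congr (_ && _); rewrite andbC.
have toe w : arc G w v -> connect e (start G) w.
  move=> wv; have /connectP[p pp lp] := reach w.
  have vp : v \notin start G :: p.
    apply/negP => vp; have /negP := left_tree_acyclic tG wv; apply.
    rewrite lp; case/splitPl: vp pp lp => p1 p2 l1.
    rewrite cat_path last_cat l1.
    by case/andP=> _ p2p _; apply/connectP; exists p2.
  apply/connectP; exists p => //.
  elim: p (start G) pp vp {lp} => //= x p IH s /andP[sx px].
  rewrite !inE !negb_or => /and3P[sv xv vp].
  rewrite arc_uarc //= eq_sym sv eq_sym xv /=.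
  by apply: IH; rewrite // inE negb_or xv.
have /connect_upath[p [pp up lp]] : connect e u u'.
  apply: connect_trans (toe _ u'v).
  by rewrite (sym_connect_sym esym) toe.
have sub : subrel e (uarc G) by move=> x y /and3P[].
have avoid q z : z != v -> path e z q -> v \notin z :: q.
  elim: q z => [|x q IH] y yv /=; first by rewrite inE eq_sym.
  case/andP=> /and3P[_ _ xv] px; rewrite inE negb_or eq_sym yv /=.
  exact: IH.
have vp : v \notin u :: p.
  apply: avoid pp; apply/eqP => eu.
  by move: (left_tree_acyclic tG uv); rewrite eu connect0.
have /cyc : ucycle (uarc G) (v :: u :: p).
  rewrite /ucycle cons_uniq vp up andbT /= rcons_path (sub_path sub pp) -lp.
  by rewrite /uarc uv u'v orbT.
by case: p lp {pp up vp} => //= eu; rewrite eu eqxx in neq.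
Qed.

Lemma arborescence_left_tree G :
  (forall v, connect (arc G) (start G) v) ->
  (forall u, ~~ arc G u (start G)) ->
  (forall u u' v, arc G u v -> arc G u' v -> u = u') ->
  is_left_tree G.
Proof.
move=> reach st par.
have acyc u v : arc G u v -> ~~ connect (arc G) v u.
  move=> uv; apply/negP => vu.
  have back w : connect (arc G) v w && connect (arc G) w v ->
      exists2 w', arc G w' w &
        connect (arc G) v w' && connect (arc G) w' v.
    case/andP=> vw wv; have [ewv|nvw] := eqVneq v w.
      by exists u; rewrite -?ewv // vu connect1.
    have [w' vw' w'w] := connect_arc_last vw nvw; exists w' => //.
    by rewrite vw' (connect_trans (connect1 w'w)).
  have : connect (arc G) v (start G) && connect (arc G) (start G) v.
    have /connectP[p pp lp] := reach v.
    have : connect (arc G) v (last (start G) p) &&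
        connect (arc G) (last (start G) p) v by rewrite -lp connect0.
    elim/last_ind: p pp {lp} => // p w IH.
    rewrite rcons_path last_rcons => /andP[pp pw] /back[w' w'w].
    by rewrite (par _ _ _ w'w pw) => /IH; apply.
  by case/back=> w ws; have := st w; rewrite ws.
pose anc v := [set u | connect (arc G) u v]%SET.
have ltanc u v : arc G u v -> #|anc u| < #|anc v|.
  move=> uv; apply: proper_card; apply/properP; split.
    by apply/fintype.subsetP => w; rewrite !inE => wu; apply: connect_trans (connect1 uv).
  by exists v; rewrite inE ?connect0 ?acyc.
split=> //; split.
- move=> u v; apply: (@connect_trans _ _ (start G)).
    rewrite (sym_connect_sym (@uarc_sym G)).
    exact: connect_sub (fun x y xy => connect1 (@arc_uarc G _ _ xy)) _ _ (reach u).
  exact: connect_sub (fun x y xy => connect1 (@arc_uarc G _ _ xy)) _ _ (reach v).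
- by move=> u v uv; apply/negP => vu; have := acyc _ _ uv; rewrite connect1.
move=> p /andP[cp up]; rewrite leqNgt; apply/negP => sp.
have [x0 x0p] : exists x, x \in p by case: p sp {cp up} => // x p; exists x; rewrite inE eqxx.
case: (arg_maxnP (P := mem p) (fun x => #|anc x|) x0p) => m mp max.
have dn w : w \in p -> uarc G m w -> arc G w m.
  move=> wp; case/orP => // /ltanc; rewrite ltnNge.
  by have /= -> := max w wp.
case: (rot_to mp) => i p' def; move: cp up sp.
rewrite -(rot_cycle i) -(rot_uniq i) -(size_rot i) def.
case: p' def => [|a p'] //; case/lastP: p' => [|p' b] // def cp up _.
move: cp; rewrite /= rcons_path last_rcons => /and3P[ma _ bm].
have inp w : w \in [:: m, a & rcons p' b] -> w \in p by rewrite -def mem_rot.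
have eab : a = b.
  apply: par (dn _ _ ma) (dn _ _ _); rewrite ?(uarc_sym _ m) //; apply: inp.
    by rewrite !inE eqxx orbT.
  by rewrite !(inE, mem_rcons) eqxx !orbT.
by move: up; rewrite /= eab mem_rcons inE eqxx /= andbF.
Qed.

Lemma start_leaf G (v : V) : is_left_tree G ->
  exists2 l, is_leaf G l & #|[set u | connect (arc G) u v]%SET| <=
    #|[set u | connect (arc G) u l]%SET|.
Proof.
move=> tG; case: (arg_maxnP (P := xpredT)
  (fun x => #|[set u | connect (arc G) u x]%SET|) (erefl : xpredT v)) => l _ lmax.
exists l; last exact: lmax.
apply/forallP => w; apply/negP => lw.
have := lmax w isT; rewrite /= leqNgt => /negP; apply.
apply: proper_card; apply/properP; split.
  by apply/fintype.subsetP => z; rewrite !inE => zl; apply: connect_trans (connect1 lw).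
by exists w; rewrite inE ?connect0 ?(left_tree_acyclic tG).
Qed.

End Arborescence.

Section Iso.
Context (X : Type).

Lemma gmorphism_id (V : finType) (G : pgraph X V) : gmorphism G G id.
Proof. by split. Qed.

Lemma gmorphism_comp (U V W : finType) (G : pgraph X U) (D : pgraph X V)
    (K : pgraph X W) f g :
  gmorphism G D f -> gmorphism D K g -> gmorphism G K (g \o f).
Proof.
case=> f1 f2 f3 [g1 g2 g3]; split; rewrite /= ?f1 ?f2 //.
by move=> u v x /f3/g3.
Qed.

Lemma giso_refl (V : finType) (G : pgraph X V) : giso G G.
Proof. by exists id, id; split => //; apply: gmorphism_id. Qed.

Lemma giso_sym (V W : finType) (G : pgraph X V) (D : pgraph X W) :
  giso G D -> giso D G.
Proof. by case=> f [g [? ? ? ?]]; exists g, f; split. Qed.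

Lemma giso_trans (U V W : finType) (G : pgraph X U) (D : pgraph X V)
    (K : pgraph X W) : giso G D -> giso D K -> giso G K.
Proof.
case=> f [f' [m m' fK f'K]] [g [g' [n n' gK g'K]]].
exists (g \o f), (f' \o g'); split.
- exact: gmorphism_comp m n.
- exact: gmorphism_comp n' m'.
- exact: can_comp.
- exact: can_comp.
Qed.

Lemma giso_card (V W : finType) (G : pgraph X V) (D : pgraph X W) :
  giso G D -> #|V| = #|W|.
Proof.
by case=> f [g [_ _ fK gK]]; apply: (bij_eq_card (f := f)); exists g.
Qed.

Lemma gmorphism_arc (V W : finType) (G : pgraph X V) (D : pgraph X W) f u v :
  gmorphism G D f -> arc G u v -> arc D (f u) (f v).
Proof.
case=> _ _ h; rewrite /arc; case E: (edge G u v) => [x|] // _.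
by rewrite (h _ _ _ E).
Qed.

Lemma giso_left_tree (V W : finType) (G : pgraph X V) (D : pgraph X W) :
  giso G D -> is_left_tree G -> is_left_tree D.
Proof.
case=> f [g [mf mg fK gK]] tG; apply: arborescence_left_tree.
- move=> v; rewrite -(gK v); have [<- _ _] := mf.
  apply: (connect_homo (e := arc G)); last by case: tG.
  by move=> x y xy; apply/connect1/(gmorphism_arc mf).
- move=> u; apply/negP => /(gmorphism_arc mg); have [-> _ _] := mg.
  by apply/negP/left_tree_start.
move=> u u' v /(gmorphism_arc mg) uv /(gmorphism_arc mg) u'v.
by apply: (can_inj gK); apply: left_tree_parent uv u'v.
Qed.

End Iso.

(** ** Isomorphism classes of left X-trees *)

(* Up to isomorphism, the vertices may be taken to be 0, ..., n - 1. *)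
Record ltree (X : Type) := LTree {
  nvert : nat;
  graph :> pgraph X 'I_nvert;
  ltreeP : is_left_tree graph }.

HB.instance Definition _ (X : Type) := gen_eqMixin (ltree X).
HB.instance Definition _ (X : Type) := gen_choiceMixin (ltree X).

Definition ltree_iso (X : Type) : rel (ltree X) := fun s t => `[< giso s t >].

Lemma ltree_iso_equiv (X : Type) : equiv_class_of (@ltree_iso X).
Proof.
split.
- by move=> s; apply/asboolP/giso_refl.
- by move=> s t; apply/asboolP/asboolP => /giso_sym.
- move=> t s u /asboolP st /asboolP tu; apply/asboolP; exact: giso_trans tu.
Qed.

Canonical ltree_iso_equiv_rel (X : Type) := EquivRelPack (@ltree_iso_equiv X).

Definition LUT1 (X : Type) := {eq_quot (@ltree_iso_equiv_rel X)}.


Section Trees.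
Context (X : Type).

Definition relabel (V : finType) (G : pgraph X V) : pgraph X 'I_#|V| :=
  PGraph (fun i j => edge G (enum_val i) (enum_val j))
         (enum_rank (start G)) (enum_rank (stop G)).

Lemma relabel_iso (V : finType) (G : pgraph X V) : giso G (relabel G).
Proof.
exists enum_rank, enum_val; split.
- by split=> //= u v x; rewrite !enum_rankK.
- by split; rewrite /= ?enum_rankK.
- exact: enum_rankK.
- exact: enum_valK.
Qed.

Definition iso_class (V : finType) (G : pgraph X V) (tG : is_left_tree G) :
    LUT1 X :=
  \pi_(LUT1 X) (LTree (giso_left_tree (relabel_iso G) tG)).

Lemma iso_class_repr (V : finType) (G : pgraph X V) (tG : is_left_tree G) :
  giso G (repr (iso_class tG)).
Proof.
apply: giso_trans (relabel_iso G) _.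
have /eqmodP/asboolP := esym (reprK (iso_class tG)).
exact.
Qed.

End Trees.

Section Constructions.
Context (X : Type).

Definition one_graph : pgraph X unit := PGraph (fun _ _ => None) tt tt.

Definition letter_graph (x : X) : pgraph X bool :=
  PGraph (fun u v => if ~~ u && v then Some x else None) false true.

Section Glue.
Context (V W : finType) (G : pgraph X V) (D : pgraph X W).

(* Disjoint union of the vertices, the start vertex of [D] being represented by
   the end vertex of [G]. *)
Definition glue_vertex : finType := (V + {w : W | w != start D})%type.

Definition glue_inr (w : W) : glue_vertex :=
  if insub w is Some w' then inr w' else inl (stop G).

(* No edge from the second part to the first: in a left tree, no edge ends at
   the start vertex. *)
Definition glue_edge (a b : glue_vertex) : option X :=
  match a, b with
  | inl u, inl v => edge G u v
  | inl u, inr w => if u == stop G then edge D (start D) (val w) else None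
  | inr w, inr w' => edge D (val w) (val w')
  | inr _, inl _ => None
  end.

Definition glue : pgraph X glue_vertex :=
  PGraph glue_edge (inl (start G)) (glue_inr (stop D)).

Lemma glue_inr_start : glue_inr (start D) = inl (stop G).
Proof. by rewrite /glue_inr insubF // eqxx. Qed.

Lemma glue_inr_val (w : {w : W | w != start D}) : glue_inr (val w) = inr w.
Proof. by rewrite /glue_inr valK. Qed.

Lemma glue_inrP w : (w = start D /\ glue_inr w = inl (stop G)) \/
  (exists2 w', val w' = w & glue_inr w = inr w').
Proof.
rewrite /glue_inr; case: insubP => [w' _ <-|]; first by right; exists w'.
by rewrite negbK => /eqP ->; left.
Qed.

Lemma glue_left_tree : is_left_tree G -> is_left_tree D -> is_left_tree glue.
Proof.
move=> tG tD; apply: arborescence_left_tree.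
- have reachl u : connect (arc glue) (inl (start G)) (inl u).
    apply: (connect_homo (e := arc G)); last by case: tG.
    by move=> a b ab; apply: connect1.
  case=> [u|w] /=; first exact: reachl.
  apply: connect_trans (reachl (stop G)) _.
  rewrite -glue_inr_start -glue_inr_val.
  apply: (connect_homo (e := arc D)); last by case: tD.
  move=> a b ab; apply: connect1.
  have [[eb _]|[b' vb ->]] := glue_inrP b.
    by move: ab; rewrite eb (negbTE (left_tree_start _ _)).
  have [[ea ->]|[a' va ->]] := glue_inrP a.
    by rewrite /arc /= eqxx vb -ea.
  by rewrite /arc /= va vb.
- case=> [u|w] //=; exact: (left_tree_start u tG).
case=> [u|w] [u'|w'] [v|v] //=; rewrite /arc /=.
- by move=> uv u'v; rewrite (left_tree_parent tG uv u'v).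
- by case: eqP => // -> _; case: eqP => // ->.
- case: eqP => // _ sv w'v; have := left_tree_parent tD sv w'v.
  by move=> e; move/eqP: (valP w'); case; exact: esym.
- case: (u' == stop G) => // wv sv; have := left_tree_parent tD sv wv.
  by move=> e; move/eqP: (valP w); case; exact: esym.
by move=> wv w'v; congr inr; apply/val_inj/(left_tree_parent tD wv w'v).
Qed.

Lemma card_glue : #|glue_vertex| = #|V| + #|W|.-1.
Proof. by rewrite card_sum card_sig cardC1. Qed.

End Glue.

Definition to_start (V : finType) (G : pgraph X V) : pgraph X V :=
  PGraph (edge G) (start G) (start G).

(* The subgraph induced on [A], with start and end vertices [a] and [b]. *)
Definition induced (V : finType) (G : pgraph X V) (A : pred V)
    (a b : {v | A v}) : pgraph X {v | A v} :=
  PGraph (fun u v => edge G (val u) (val v)) a b.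

Lemma one_left_tree : is_left_tree one_graph.
Proof.
by apply: arborescence_left_tree => //; case; exact: connect0.
Qed.

Lemma letter_left_tree x : is_left_tree (letter_graph x).
Proof.
apply: arborescence_left_tree => [[]|[]|[] [] []] //.
exact: connect1.
Qed.

Lemma to_start_left_tree (V : finType) (G : pgraph X V) :
  is_left_tree G -> is_left_tree (to_start G).
Proof. by []. Qed.

(* The directed path from the start vertex to [v] consists of the vertices from
   which [v] can be reached. *)
Definition on_path (V : finType) (G : pgraph X V) (v : V) : pred V :=
  fun u => connect (arc G) u v.

Definition path_graph (V : finType) (G : pgraph X V) (tG : is_left_tree G)
    (v : V) : pgraph X {u | on_path G v u} :=
  let s := exist _ (start G) (tG.2 v) in @induced V G (on_path G v) s s.

Lemma path_left_tree (V : finType) (G : pgraph X V) (tG : is_left_tree G)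
  (v : V) : is_left_tree (path_graph tG v).
Proof.
apply: arborescence_left_tree.
- case=> u uv; have /connectP[p pp lp] := tG.2 u; rewrite /=.
  elim/last_ind: p u uv pp lp => [|p w IH] u uv /=.
    by move=> _ eu; rewrite (_ : exist _ _ _ = exist _ u uv) //; apply: val_inj.
  rewrite rcons_path last_rcons => /andP[pp pw] eu.
  have lv : on_path G v (last (start G) p).
    by apply: connect_trans uv; apply: connect1; rewrite eu.
  apply: connect_trans (IH _ lv pp erefl) _; apply: connect1.
  by rewrite /arc /= eu.
- by move=> u; apply: (left_tree_start (val u) tG).
by move=> u u' w uw u'w; apply/val_inj/(left_tree_parent tG uw u'w).
Qed.

Definition retraction (V : finType) (G : pgraph X V) (f : V -> V) : Prop :=
  gmorphism G G f /\ (forall v, f (f v) = f v).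

Lemma retraction_start (V : finType) (G : pgraph X V) f :
  retraction G f -> f (start G) == start G.
Proof. by case=> [[-> _ _] _]. Qed.

Lemma retraction_stop (V : finType) (G : pgraph X V) f :
  retraction G f -> f (stop G) == stop G.
Proof. by case=> [[_ -> _] _]. Qed.

(* The image of an idempotent map is its set of fixed points, and every edge
   between fixed points of a retraction is the image of itself. *)
Definition image_graph (V : finType) (G : pgraph X V) (f : V -> V)
    (rf : retraction G f) : pgraph X {v | f v == v} :=
  @induced V G (fun v => f v == v)
    (exist _ (start G) (retraction_start rf))
    (exist _ (stop G) (retraction_stop rf)).

Definition is_pruned (V : finType) (G : pgraph X V) : Prop :=
  forall f, retraction G f -> forall v, f v = v.

End Constructions.

(** ** Operations on LUT^1(X) *)

Section LUT.
Context (X : Type).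
Implicit Types c d : LUT1 X.

Definition lut_one : LUT1 X := iso_class (one_left_tree X).

Definition lut_letter (x : X) : LUT1 X := iso_class (letter_left_tree x).

(* The operations on representatives respect isomorphism, so the choice of
   [repr] is immaterial here and below. *)
Definition lut_mul c d : LUT1 X :=
  iso_class (glue_left_tree (ltreeP (repr c)) (ltreeP (repr d))).

Definition lut_plus c : LUT1 X :=
  iso_class (to_start_left_tree (ltreeP (repr c))).

Definition lutE : set (LUT1 X) :=
  [set c | start (graph (repr c)) = stop (graph (repr c))].

Definition lut_path c (v : 'I_(nvert (repr c))) : LUT1 X :=
  iso_class (path_left_tree (ltreeP (repr c)) v).

(* In [prune] and [splay] below, the set given to [xget] is a singleton: every
   tree has exactly one pruned retract and exactly one branch decomposition. So
   the default value [c] plays no role. *)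
Definition is_pruning c d : Prop :=
  is_pruned (repr d) /\
  exists (f : _ -> _) (rf : retraction (repr c) f), giso (image_graph rf) (repr d).

Definition prune c : LUT1 X := xget c [set d | is_pruning c d].

(* Splay on E(X), where [lut_mul] is commutative, so that the order of the
   factors is irrelevant. *)
Definition splayE c : LUT1 X :=
  \big[lut_mul/lut_one]_(v | is_leaf (repr c) v) lut_path v.

Definition branch_product (b : LUT1 X) (s : seq (X * LUT1 X)) : LUT1 X :=
  foldl (fun t xb => lut_mul (lut_mul t (lut_letter xb.1)) xb.2) b s.

Definition is_splay c d : Prop :=
  exists (b : lutE) (s : seq (X * lutE)),
    c = branch_product (val b) [seq (xb.1, val xb.2) | xb <- s] /\
    d = branch_product (splayE (val b))
          [seq (xb.1, splayE (val xb.2)) | xb <- s].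

Definition splay c : LUT1 X := xget c [set d | is_splay c d].

Definition hat c : LUT1 X := prune (splay c).

Definition H_set : set (LUT1 X) := range hat.

Definition nontriv c := 1 < nvert (repr c).

Lemma nvert_class (V : finType) (G : pgraph X V) (tG : is_left_tree G) :
  nvert (repr (iso_class tG)) = #|V|.
Proof. by rewrite (giso_card (iso_class_repr tG)) card_ord. Qed.

Lemma nvert_gt0 c : 0 < nvert (repr c).
Proof. exact: leq_trans (ltn_ord (start (repr c))). Qed.

Lemma nontriv_one : nontriv lut_one = false.
Proof. by rewrite /nontriv nvert_class card_unit. Qed.

Lemma nontriv_letter x : nontriv (lut_letter x).
Proof. by rewrite /nontriv nvert_class card_bool. Qed.

Lemma nontriv_mul c d : nontriv (lut_mul c d) = nontriv c || nontriv d.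
Proof.
rewrite /nontriv nvert_class card_glue !card_ord.
have := nvert_gt0 c; have := nvert_gt0 d.
case: (nvert (repr c)) => [|[|m]] //; case: (nvert (repr d)) => [|[|n]] //.
Qed.

Lemma nontrivP c : nontriv c = (c != lut_one).
Proof.
have [->|ne] := eqVneq c lut_one; first exact: nontriv_one.
apply/negPn/negP => n1; case/eqP: ne.
rewrite -[c]reprK -[lut_one]reprK; apply/eqmodP/asboolP.
apply: giso_trans (iso_class_repr (one_left_tree X)).
have all1 (u v : 'I_(nvert (repr c))) : u = v.
  suff /fintype_le1P/(_ v u) : #|'I_(nvert (repr c))| <= 1 by [].
  by rewrite card_ord leqNgt.
exists (fun _ => tt), (fun _ => start (repr c)); split=> //.
- split=> //= u v x uvx.
  have := left_tree_start u (ltreeP (repr c)).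
  by rewrite -(all1 v (start (repr c))) /arc uvx.
- by case.
Qed.

Lemma ex_other (V : finType) (s : V) : 1 < #|V| -> exists v, v != s.
Proof.
rewrite (cardD1 s) inE add1n ltnS => /card_gt0P[v].
by rewrite !inE andbT; exists v.
Qed.

Lemma nontriv_splayE c : nontriv c -> nontriv (splayE c).
Proof.
move=> nc; set G := graph (repr c); have tG : is_left_tree G by apply: ltreeP.
have [v nv] : exists v, v != start G by apply: ex_other; rewrite card_ord.
have [l ll lv] := start_leaf v tG.
have npl : nontriv (lut_path (c := c) l).
  rewrite /nontriv nvert_class card_sig -cardsE; apply: leq_trans lv.
  apply: leq_trans (subset_leq_card (A := [set v; start G]%SET) _).
    by rewrite cards2 nv.
  apply/fintype.subsetP => w; rewrite !inE => /orP[] /eqP -> //.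
  by case: tG => _ ->.
rewrite /splayE; have := mem_index_enum l.
elim: (index_enum _) => // w r IH; rewrite inE big_cons.
case/orP => [/eqP <-|/IH{}IH]; first by rewrite ll nontriv_mul npl.
by case: ifP => _ //; rewrite nontriv_mul IH orbT.
Qed.

Lemma nontriv_branch b s :
  nontriv (branch_product b s) = nontriv b || (0 < size s).
Proof.
elim: s b => [|[x c] s IH] b /=; first by rewrite orbF.
by rewrite IH !nontriv_mul nontriv_letter !orbT.
Qed.

Lemma nontriv_splay c : nontriv c -> nontriv (splay c).
Proof.
move=> nc; rewrite /splay; case: xgetP => // d _ [b [s [ec ->]]].
move: nc; rewrite ec !nontriv_branch.
by case: s {ec} => [|? ?] /=; rewrite ?orbT // !orbF => /nontriv_splayE.
Qed.

Lemma nontriv_prune c : nontriv c -> nontriv (prune c).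
Proof.
move=> nc; rewrite /prune; case: xgetP => // d _ [_ [f [rf isof]]].
have tG := ltreeP (repr c); set G := graph (repr c) in rf isof tG.
rewrite /nontriv -[nvert _]card_ord -(giso_card isof) card_sig.
have [v nv] : exists v, v != start G by apply: ex_other; rewrite card_ord.
have [u su] : exists u, arc G (start G) u.
  have /connectP[[|u p] /= pp lp] := tG.2 v; first by rewrite lp eqxx in nv.
  by case/andP: pp; exists u.
have sfu : arc G (start G) (f u).
  by rewrite -{1}(eqP (retraction_start rf)); apply: gmorphism_arc rf.1 su.
apply: leq_trans (subset_leq_card (A := [set f u; start G]%SET) _).
  rewrite cards2 (_ : f u != start G) //; apply/eqP => e.
  by move: (left_tree_start (start G) tG); rewrite -{2}e sfu.
apply/fintype.subsetP => w; rewrite !inE => /orP[] /eqP ->.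
  by rewrite rf.2.
exact: retraction_start rf.
Qed.

Lemma hat_neq1 c : c <> lut_one -> hat c <> lut_one.
Proof.
move=> /eqP; rewrite -nontrivP => /nontriv_splay/nontriv_prune.
by rewrite nontrivP => /eqP.
Qed.

Lemma lut_mul_neq1 c d : c <> lut_one -> lut_mul c d <> lut_one.
Proof.
move=> /eqP; rewrite -nontrivP => nc.
by apply/eqP; rewrite -nontrivP nontriv_mul nc.
Qed.

Lemma lut_plus_neq1 c : c <> lut_one -> lut_plus c <> lut_one.
Proof.
move=> /eqP; rewrite -nontrivP => nc; apply/eqP.
by rewrite -nontrivP /nontriv nvert_class card_ord.
Qed.

End LUT.

Arguments lutE X : clear implicits.
Arguments H_set X : clear implicits.

(** ** The (2,1)-algebra H(X) \ {epsilon} *)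

Section HAlgebra.
Context (X : Type).

Definition H_pos : set (LUT1 X) := H_set X `\ lut_one X.

Lemma H_pos_hat c : c <> lut_one X -> hat c \in H_pos.
Proof.
by move=> nc; apply/mem_set; split; [exists c|apply: hat_neq1].
Qed.

Lemma H_pos_neq1 (c : H_pos) : val c <> lut_one X.
Proof. by case: (set_mem (valP c)). Qed.

Definition H_pos_mul (c d : H_pos) : H_pos :=
  exist _ (hat (lut_mul (val c) (val d)))
    (H_pos_hat (lut_mul_neq1 (H_pos_neq1 (c := c)))).

Definition H_pos_plus (c : H_pos) : H_pos :=
  exist _ (hat (lut_plus (val c))) (H_pos_hat (lut_plus_neq1 (H_pos_neq1 (c := c)))).

Definition H_pos_algebra : algebra21 := Algebra21 H_pos_mul H_pos_plus.

End HAlgebra.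

Arguments H_pos X : clear implicits.

(* Main.v *)
(* A tree is encoded by its trunk word x_1 ... x_k together with the languages
   L_0, ..., L_k of the directed walks that start at its trunk vertices. Gluing
   and relocation of the end vertex act on such codes by explicit formulas, from
   which the axioms of left h-Ehresmann semigroups are read off, and neither
   splaying nor pruning changes the code.  Conversely, the branches of a splayed
   tree are bunches of paths, so a splayed tree has a morphism into every tree
   with the same code; two splayed trees with the same code are thus
   homomorphically equivalent and have the same pruned retract.  So the elements
   of H(X) correspond to codes.

   To map a code into a left h-Ehresmann semigroup S, adjoin an identity to S and
   send the code to e_0 x_1 e_1 ... x_k e_k, where e_i is the meet of the
   projections w^+ for w in L_i.  The identity (x z^+ y)^+ = (xy)^+ (xz)^+ says
   that left multiplication preserves binary meets of projections, which makes
   this assignment multiplicative. *)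

From mathcomp Require Import all_boot.
From mathcomp Require Import boolp classical_sets.
Require Import Defs.

Set Implicit Arguments.
Unset Strict Implicit.
Unset Printing Implicit Defensive.

Local Open Scope quotient_scope.
Local Open Scope classical_set_scope.

(** * Walks and languages *)

Section Walks.
Context (Y V : Type) (step : Y -> V -> V -> Prop).

Fixpoint walk (u : V) (w : seq Y) (v : V) : Prop :=
  if w is y :: w' then exists2 t, step y u t & walk t w' v else u = v.

Lemma walk_cat u w1 w2 v :
  walk u (w1 ++ w2) v <-> exists2 t, walk u w1 t & walk t w2 v.
Proof.
elim: w1 u => [|y w1 IH] u /=.
  by split=> [|[t ->]]; [exists u|].
split=> [[t ut /IH[z tz zv]]|[z [t ut tz] zv]].
  by exists z => //; exists t.
by exists t => //; apply/IH; exists z.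
Qed.

Lemma walk_rcons u w y v :
  walk u (rcons w y) v <-> exists2 t, walk u w t & step y t v.
Proof.
rewrite -cats1; split.
  by case/walk_cat=> t ut /= [z tz <-]; exists t.
by case=> t ut tv; apply/walk_cat; exists t => //=; exists v.
Qed.

(** A walk can be traced back from its end, since each vertex has at most one incoming step; as no
    step enters [s], neither word can run on when the other is exhausted. The abstract [step] covers
    both labelled edges and the trunk steps [cstep]. *)
Lemma walk_inj s w w' v :
  (forall y u, ~ step y u s) ->
  (forall y y' u u' z, step y u z -> step y' u' z -> y = y' /\ u = u') ->
  walk s w v -> walk s w' v -> w = w'.
Proof.
move=> nos det; elim/last_ind: w w' v => [|w y IH] w' v; case/lastP: w' => [|w' y'] //.
- by move=> /= <- /walk_rcons[t _ /nos].
- by move=> + /= e; rewrite -e => /walk_rcons[t _ /nos].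
case/walk_rcons=> t wt tv /walk_rcons[t' wt' tv'].
have [<- et] := det _ _ _ _ _ tv tv'; congr rcons.
by apply: IH wt _; rewrite et.
Qed.

End Walks.

Lemma walk_homo (Y V V' : Type) (step : Y -> V -> V -> Prop)
    (step' : Y -> V' -> V' -> Prop) (f : V -> V') u w v :
  (forall y a b, step y a b -> step' y (f a) (f b)) ->
  walk step u w v -> walk step' (f u) w (f v).
Proof.
move=> h; elim: w u => [|y w IH] u /=; first by move->.
by case=> t /h ut /IH tv; exists (f t).
Qed.

Section Languages.
Context (X : Type) (V : finType).
Implicit Type G : pgraph X V.

Definition lstep G (x : X) (u v : V) : Prop := edge G u v = Some x.

Definition lang G (u : V) : set (seq X) :=
  [set w | exists v, walk (lstep G) u w v].

Lemma lstep_arc G x u v : lstep G x u v -> arc G u v.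
Proof. by rewrite /lstep /arc => ->. Qed.

Lemma arc_lstep G u v : arc G u v -> exists x, lstep G x u v.
Proof. by rewrite /lstep /arc; case: (edge G u v) => [x|//] _; exists x. Qed.

Lemma walk_connect G u w v : walk (lstep G) u w v -> connect (arc G) u v.
Proof.
elim: w u => [|x w IH] u /=; first by move->.
by case=> t /lstep_arc ut /IH; apply: connect_trans (connect1 ut).
Qed.

Lemma connect_walk G u v :
  connect (arc G) u v -> exists w, walk (lstep G) u w v.
Proof.
case/connectP=> p; elim: p u => [|t p IH] u /=.
  by move=> _ ->; exists [::].
case/andP=> /arc_lstep[x ut] tp /(IH _ tp)[w tv].
by exists (x :: w), t.
Qed.

Lemma lstep_det G : is_left_tree G ->
  forall x x' u u' v, lstep G x u v -> lstep G x' u' v -> x = x' /\ u = u'.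
Proof.
move=> tG x x' u u' v uv u'v.
have e := left_tree_parent tG (lstep_arc uv) (lstep_arc u'v).
by split=> //; move: uv u'v; rewrite -e /lstep => -> [].
Qed.

Lemma lstep_start G : is_left_tree G -> forall x u, ~ lstep G x u (start G).
Proof. by move=> tG x u /lstep_arc; apply/negP/left_tree_start. Qed.

(** Walks from the start vertex are covered by [walk_inj]; a word [q] leading to [u] is put in front
    and then cancelled. *)
Lemma walk_word_uniq G u v w w' : is_left_tree G ->
  walk (lstep G) u w v -> walk (lstep G) u w' v -> w = w'.
Proof.
move=> tG uv uv'; have [q qu] := connect_walk (tG.2 u).
have h r : walk (lstep G) u r v -> walk (lstep G) (start G) (q ++ r) v.
  by move=> ur; apply/walk_cat; exists u.
have := walk_inj (lstep_start tG) (lstep_det tG) (h _ uv) (h _ uv').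
by move/(congr1 (drop (size q))); rewrite !drop_size_cat.
Qed.

(* The trunk of [G] is read off with the language of each vertex after the
   start vertex; the language of the start vertex is the first component. *)
Definition cstep G (y : X * set (seq X)) (u v : V) : Prop :=
  lstep G y.1 u v /\ lang G v = y.2.

Definition has_code G (m : set (seq X) * seq (X * set (seq X))) : Prop :=
  m.1 = lang G (start G) /\ walk (cstep G) (start G) m.2 (stop G).

Lemma has_code_uniq G m m' : is_left_tree G ->
  has_code G m -> has_code G m' -> m = m'.
Proof.
case: m m' => [L s] [L' s'] tG [/= -> w] [/= -> w']; congr pair.
apply: walk_inj w w'.
  by move=> y u [/(lstep_start tG)].
move=> [x N] [x' N'] u u' v [/= uv <-] [/= u'v <-].
by have [-> ->] := lstep_det tG uv u'v.
Qed.

Lemma has_code_ex G : is_left_tree G -> exists m, has_code G m.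
Proof.
move=> tG; have [w ww] := connect_walk (tG.2 (stop G)).
suff [s ss] : exists s, walk (cstep G) (start G) s (stop G).
  by exists (lang G (start G), s).
elim: w (start G) ww => [|x w IH] u /=; first by exists [::].
by case=> t ut /IH[s ts]; exists ((x, lang G t) :: s), t.
Qed.

End Languages.

Section LanguageMaps.
Context (X : Type) (V W : finType) (G : pgraph X V) (D : pgraph X W).

Lemma gmorphism_walk f u w v : gmorphism G D f ->
  walk (lstep G) u w v -> walk (lstep D) (f u) w (f v).
Proof. by case=> _ _ h; apply: walk_homo => x a b; apply: h. Qed.

Lemma gmorphism_lang f u : gmorphism G D f -> lang G u `<=` lang D (f u).
Proof. by move=> mf w [v uv]; exists (f v); apply: gmorphism_walk uv. Qed.

Lemma has_code_map f m : gmorphism G D f ->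
  (forall u, lang G u = lang D (f u)) -> has_code G m -> has_code D m.
Proof.
move=> mf lf [e w]; have [es et h] := mf; split; first by rewrite e lf es.
rewrite -es -et.
apply: walk_homo w => -[x N] a b [/= /h ab <-]; split=> //=.
Qed.

End LanguageMaps.

Lemma giso_code (X : Type) (V W : finType) (G : pgraph X V) (D : pgraph X W) m :
  giso G D -> has_code G m -> has_code D m.
Proof.
case=> f [g [mf mg fK gK]]; apply: has_code_map (mf) _ => u.
rewrite eqEsubset; split; first exact: gmorphism_lang.
by have := gmorphism_lang (u := f u) mg; rewrite fK.
Qed.

Section ImageGraph.
Context (X : Type) (V : finType) (G : pgraph X V) (f : V -> V).
Context (rf : retraction G f).

Lemma val_gmorphism : gmorphism (image_graph rf) G val.
Proof. by []. Qed.

Lemma retract_gmorphism :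
  exists r, gmorphism G (image_graph rf) r /\ forall v, val (r v) = f v.
Proof.
exists (fun v => exist _ (f v) (introT eqP (rf.2 v))); split=> //.
have [[es et ef] _] := rf.
by split; [apply: val_inj|apply: val_inj|move=> u v x /ef].
Qed.

(** A fixed point has the same language in the image as in [G]: the inclusion maps walks one way and
    the retraction maps them back. *)
Lemma image_graph_code m : has_code (image_graph rf) m -> has_code G m.
Proof.
have [r [mr rE]] := retract_gmorphism.
apply: has_code_map val_gmorphism _ => v; rewrite eqEsubset; split.
  exact: gmorphism_lang val_gmorphism.
rewrite -[in X in _ `<=` X](_ : r (val v) = v); first exact: gmorphism_lang mr.
by apply: val_inj; rewrite rE (eqP (valP v)).
Qed.

End ImageGraph.

(** * The code of a tree *)

Section CodeAlgebra.
Context (X : Type).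
Implicit Types (L : set (seq X)) (s : seq (X * set (seq X))).

Definition word s : seq X := [seq y.1 | y <- s].

(** Effect on a trunk of gluing a tree with root language [L] to its end: from the vertex after [x],
    the new words follow the remaining trunk [word r] and continue in [L]. *)
Fixpoint graft s L : seq (X * set (seq X)) :=
  if s is (x, N) :: r then (x, N `|` cat (word r) @` L) :: graft r L else [::].

Definition code_algebra : algebra21 :=
  @Algebra21 (set (seq X) * seq (X * set (seq X)))
    (fun m n => (m.1 `|` cat (word m.2) @` n.1, graft m.2 n.1 ++ n.2))
    (fun m => (m.1, [::])).

Lemma image_cat0 L : cat [::] @` L = L.
Proof. exact: image_id. Qed.

Lemma image_cat u v L : cat (u ++ v) @` L = cat u @` (cat v @` L).
Proof.
by rewrite image_comp; congr image; apply/funext => w; rewrite /= catA.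
Qed.

Lemma word_graft s L : word (graft s L) = word s.
Proof. by elim: s => [|[x N] s IH] //=; rewrite IH. Qed.

Lemma graft_cat s s' L :
  graft (s ++ s') L = graft s (cat (word s') @` L) ++ graft s' L.
Proof.
elim: s => [|[x N] s IH] //=; rewrite IH; congr ((_, _ `|` _) :: _).
by rewrite /word map_cat image_cat.
Qed.

Lemma graft_setU s L L' : graft s (L `|` L') = graft (graft s L) L'.
Proof.
elim: s => [|[x N] s IH] //=.
by rewrite IH image_setU setUA word_graft.
Qed.

(** The projection keeps only the first component, so the last identity amounts to prefixing by the
    trunk word distributing over unions. *)
Lemma code_left_h_Ehresmann : left_h_Ehresmann code_algebra.
Proof.
split; first split.
- move=> [L s] [L' s'] [L'' s''] /=; congr pair.
    by rewrite image_setU setUA /word map_cat -!/(word _) word_graft image_cat.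
  by rewrite graft_cat graft_setU catA.
- by move=> [L s] /=; rewrite image_cat0 setUid.
- by [].
- by move=> [L s] [L' s'] /=; rewrite !image_cat0 setUC.
- by [].
move=> [L s] [L' s'] [L'' s''] /=; congr pair.
rewrite cats0 word_graft image_cat0 -setUUr -setUA; congr setU.
exact: setUC.
Qed.

End CodeAlgebra.

Section GlueCode.
Context (X : Type) (V W : finType) (G : pgraph X V) (D : pgraph X W).
Context (tG : is_left_tree G) (tD : is_left_tree D).

Lemma lstep_glue_inr x w w' : lstep D x w w' ->
  lstep (glue G D) x (glue_inr G D w) (glue_inr G D w').
Proof.
move=> ww'; rewrite /lstep /=.
have [[e _]|[b eb ->]] := glue_inrP G D w'.
  by case: (lstep_start tD (x := x) (u := w)); rewrite -e.
have [[ea ->]|[a ea ->]] /= := glue_inrP G D w; last by rewrite ea eb.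
by rewrite eqxx; move: ww'; rewrite ea -eb.
Qed.

Lemma walk_glue_inr u w v : walk (lstep D) u w v ->
  walk (lstep (glue G D)) (glue_inr G D u) w (glue_inr G D v).
Proof. by apply: walk_homo => x a b; apply: lstep_glue_inr. Qed.

Lemma lang_glue_inr (w : {w | w != start D}) :
  lang (glue G D) (inr w) = lang D (val w).
Proof.
rewrite eqEsubset; split=> q [z].
  elim: q w => [|x q IH] w /=; first by exists (val w).
  case=> -[//|w'] ww' /IH[v w'v]; exists v, (val w') => //.
by move/walk_glue_inr; rewrite glue_inr_val; exists (glue_inr G D z).
Qed.

(** A walk starting in [G] stays there or crosses into [D] through the end vertex of [G]; the word
    read before the crossing must be [r], by uniqueness of words. *)
Lemma lang_glue_inl u r : walk (lstep G) u r (stop G) ->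
  lang (glue G D) (inl u) = lang G u `|` cat r @` lang D (start D).
Proof.
move=> ur; have inl_walk a p b : walk (lstep G) a p b ->
    walk (lstep (glue G D)) (inl a) p (inl b) by apply: walk_homo.
rewrite eqEsubset; split=> q; last first.
  case=> [[z /inl_walk uz]|[p [z /walk_glue_inr pz] <-]]; first by exists (inl z).
  exists (glue_inr G D z); apply/walk_cat; exists (inl (stop G)).
    exact: inl_walk.
  by rewrite -(glue_inr_start G D).
(* The induction moves [u] to vertices that may not reach the end vertex, so the word up to the
   crossing is left open and identified with [r] afterwards. *)
suff {ur} split_lang : lang (glue G D) (inl u) q -> lang G u q \/
    exists p1 p2, [/\ q = p1 ++ p2, walk (lstep G) u p1 (stop G) &
      lang D (start D) p2].
  case/split_lang=> [|[p1 [p2 [-> up1 p2D]]]]; first by left.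
  by rewrite (walk_word_uniq tG ur up1); right; exists p2.
elim: q u => [|x q IH] u; first by left; exists u.
case=> z /= [[u'|w] ut tz].
  have /IH[[v u'v]|[p1 [p2 [-> u'p1 p2D]]]] : lang (glue G D) (inl u') q.
      by exists z.
    by left; exists v, u'.
  by right; exists (x :: p1), p2; split=> //; exists u'.
have : lang (glue G D) (inr w) q by exists z.
rewrite lang_glue_inr => -[v wv]; right; exists [::], (x :: q).
move: ut; rewrite /lstep /=; case: eqP => // -> sw; split=> //.
by exists v, (val w).
Qed.

Lemma walk_cstep_word (U : finType) (K : pgraph X U) a s b :
  walk (cstep K) a s b -> walk (lstep K) a (word s) b.
Proof.
elim: s a => [|[x N] s IH] a //= [c [/= ac _] /IH cb]; by exists c.
Qed.

Lemma glue_code m n : has_code G m -> has_code D n ->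
  has_code (glue G D) (@amul (code_algebra X) m n).
Proof.
case: m n => [L s] [L' s'] [/= -> Gs] [/= -> Ds']; split=> /=.
  by rewrite (lang_glue_inl (walk_cstep_word Gs)).
apply/walk_cat; exists (inl (stop G)).
  elim: s (start G) Gs => [|[x N] s IH] u /=; first by move->.
  case=> t [/= ut <-] ts; exists (inl t); last exact: IH.
  by split=> //=; rewrite (lang_glue_inl (walk_cstep_word ts)).
rewrite -(glue_inr_start G D); apply: walk_homo Ds' => -[x N] a b [/= ab <-].
split=> /=; first exact: lstep_glue_inr.
have [[e _]|[b' <- ->]] := glue_inrP G D b; last exact: lang_glue_inr.
by case: (lstep_start tD (x := x) (u := a)); rewrite -e.
Qed.

End GlueCode.

(** * Isomorphisms *)

Section Isomorphisms.
Context (X : Type).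

Lemma giso_bij (V W : finType) (G : pgraph X V) (D : pgraph X W) (f : V -> W) :
  injective f -> (forall w, exists v, f v = w) ->
  f (start G) = start D -> f (stop G) = stop D ->
  (forall u v, edge D (f u) (f v) = edge G u v) -> giso G D.
Proof.
move=> fI fS fs ft fe; pose g w := projT1 (cid (fS w)).
have gK : cancel g f by move=> w; rewrite /g; case: cid.
exists f, g; split=> //; last by move=> v; apply: fI; rewrite gK.
  by split=> // u v x; rewrite fe.
split; first by apply: fI; rewrite gK.
  by apply: fI; rewrite gK.
by move=> u v x; rewrite -fe !gK.
Qed.

(** Recognises a gluing from two embedded copies that meet in one vertex. Edges of [D] are compared
    only when they end off [start D], because the edges of [glue] into the shared vertex are those
    of [G]. *)
Lemma glue_giso (U V W : finType) (G : pgraph X V) (D : pgraph X W)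
    (K : pgraph X U) (i : V -> U) (j : W -> U) :
  injective i -> injective j ->
  (forall v w, i v = j w -> w = start D) -> i (stop G) = j (start D) ->
  (forall u, (exists v, i v = u) \/ exists w, j w = u) ->
  i (start G) = start K -> j (stop D) = stop K ->
  (forall v v', edge K (i v) (i v') = edge G v v') ->
  (forall w w', w' != start D -> edge K (j w) (j w') = edge D w w') ->
  (forall v w, v != stop G -> w != start D -> edge K (i v) (j w) = None) ->
  (forall v w, w != start D -> edge K (j w) (i v) = None) ->
  giso (glue G D) K.
Proof.
move=> iI jI ij ijs ijS es et ei ej eij eji.
pose f (a : glue_vertex V D) := match a with inl v => i v | inr w => j (val w) end.
apply: (giso_bij (f := f)).
- case=> [v|w] [v'|w'] /= e.
  + by rewrite (iI _ _ e).
  + by case/eqP: (valP w'); apply: ij e.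
  + by case/eqP: (valP w); apply: ij (esym e).
  + by congr inr; apply/val_inj/jI.
- move=> u; case: (ijS u) => [[v <-]|[w <-]]; first by exists (inl v).
  have [e|ne] := eqVneq w (start D); first by exists (inl (stop G)); rewrite e.
  by exists (inr (exist _ w ne)).
- exact: es.
- rewrite /=; have [[e ->]|[w e ->]] := glue_inrP G D (stop D) => /=.
    by rewrite ijs -e.
  by rewrite e.
case=> [v|w] [v'|w'] //=; last by rewrite ej ?(valP w').
- case: eqP => [->|/eqP nv]; last by rewrite eij ?(valP w').
  by rewrite ijs ej ?(valP w').
- by rewrite eji ?(valP w).
Qed.

Lemma glue_inr_inj (V W : finType) (G : pgraph X V) (D : pgraph X W) :
  injective (glue_inr G D).
Proof.
move=> a b; have [[-> ->]|[a' <- ->]] := glue_inrP G D a;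
  have [[-> ->]|[b' <- ->]] := glue_inrP G D b => //.
by move=> [->].
Qed.

Lemma giso_glue (V V' W W' : finType) (G : pgraph X V) (G' : pgraph X V')
    (D : pgraph X W) (D' : pgraph X W') :
  giso G G' -> giso D D' -> giso (glue G D) (glue G' D').
Proof.
have edge_giso (A B : finType) (H : pgraph X A) (H' : pgraph X B) f g :
    gmorphism H H' f -> gmorphism H' H g -> cancel f g ->
    forall u v, edge H' (f u) (f v) = edge H u v.
  case=> _ _ hf [_ _ hg] fK u v; case E: (edge H u v) => [x|].
    exact: hf.
  by case E': (edge _ _ _) => [x|//]; move: (hg _ _ _ E'); rewrite !fK E.
case=> f [f' [mf mf' fK f'K]] [g [g' [mg mg' gK g'K]]].
have [fs ft _] := mf; have [gs gt _] := mg.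
have gn w : w != start D -> exists2 w', val w' = g w & glue_inr G' D' (g w) = inr w'.
  move=> nw; have [[e _]|//] := glue_inrP G' D' (g w).
  by case/eqP: nw; apply: (can_inj gK); rewrite e.
apply: (glue_giso (i := inl \o f) (j := glue_inr G' D' \o g)).
- by move=> a b [] /(can_inj fK).
- by move=> a b /glue_inr_inj/(can_inj gK).
- move=> v w /=; have [//|/gn[w' _ ->]] := eqVneq w (start D); discriminate.
- by rewrite /= gs glue_inr_start ft.
- case=> [v|w]; first by left; exists (f' v); rewrite /= f'K.
  by right; exists (g' (val w)); rewrite /= g'K glue_inr_val.
- by rewrite /= fs.
- by rewrite /= gt.
- exact: (edge_giso _ _ _ _ _ _ mf mf' fK).
- move=> w w' /gn[b eb /= ->]; rewrite -(edge_giso _ _ _ _ _ _ mg mg' gK).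
  have [e|/gn[a ea ->]] := eqVneq w (start D); last by rewrite /= ea eb.
  by rewrite e gs glue_inr_start /= eqxx eb.
- move=> v w nv /gn[b eb /= ->]; case: eqP => // e.
  by case/eqP: nv; apply: (can_inj fK); rewrite ft.
- by move=> v w /gn[b eb /= ->].
Qed.

Lemma lut_eqP (c d : LUT1 X) : giso (repr c) (repr d) -> c = d.
Proof. by move=> cd; rewrite -[c]reprK -[d]reprK; apply/eqmodP/asboolP. Qed.

Lemma iso_class_eq (V W : finType) (G : pgraph X V) (D : pgraph X W)
    (tG : is_left_tree G) (tD : is_left_tree D) :
  giso G D -> iso_class tG = iso_class tD.
Proof.
move=> GD; apply: lut_eqP; apply: giso_trans (iso_class_repr tD).
exact: giso_trans (giso_sym (iso_class_repr tG)) GD.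
Qed.

Lemma iso_classK (c : LUT1 X) : iso_class (ltreeP (repr c)) = c.
Proof. by apply/lut_eqP/giso_sym/iso_class_repr. Qed.

Lemma lut_mul_class (V W : finType) (G : pgraph X V) (D : pgraph X W)
    (tG : is_left_tree G) (tD : is_left_tree D) :
  lut_mul (iso_class tG) (iso_class tD) = iso_class (glue_left_tree tG tD).
Proof. by apply/iso_class_eq/giso_glue; apply/giso_sym/iso_class_repr. Qed.

Lemma lut_mul1l (c : LUT1 X) : lut_mul (lut_one X) c = c.
Proof.
rewrite -{2}(iso_classK c) -[in LHS](iso_classK c) lut_mul_class.
set D := graph _; have tD : is_left_tree D := ltreeP _; apply: iso_class_eq.
apply: (glue_giso (i := fun=> start D) (j := id)) => //.
- by case=> [] [].
- by move=> u; right; exists u.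
- move=> [] []; case E: (edge _ _ _) => [x|//].
  by case: (lstep_start tD (x := x) (u := start D)).
- move=> v w _; case E: (edge _ _ _) => [x|//].
  by case: (lstep_start tD (x := x) (u := w)).
Qed.

Lemma lut_mulr1 (c : LUT1 X) : lut_mul c (lut_one X) = c.
Proof.
rewrite -{2}(iso_classK c) -[in LHS](iso_classK c) lut_mul_class.
set G := graph _; have tG : is_left_tree G := ltreeP _; apply: iso_class_eq.
apply: (glue_giso (i := id) (j := fun=> stop G)) => //.
- by case=> [] [].
- by move=> ? [].
- by move=> u; left; exists u.
Qed.

End Isomorphisms.

(** * Codes of isomorphism classes *)

Section ClassCodes.
Context (X : Type).
Implicit Types c d : LUT1 X.

Definition code c : code_algebra X := projT1 (cid (has_code_ex (ltreeP (repr c)))).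

Lemma codeP c : has_code (repr c) (code c).
Proof. by rewrite /code; case: cid. Qed.

(** Codes are unique and invariant under isomorphism, so the code of a class can be computed on any
    graph in it. *)
Lemma code_class (V : finType) (G : pgraph X V) (tG : is_left_tree G) m :
  has_code G m -> code (iso_class tG) = m.
Proof.
move=> Gm; apply: has_code_uniq (codeP _) _; first exact: ltreeP.
exact: giso_code (iso_class_repr tG) Gm.
Qed.

Lemma code_mul c d : code (lut_mul c d) = amul (code c) (code d).
Proof. by apply/code_class/glue_code; try exact: ltreeP; apply: codeP. Qed.

Lemma code_plus c : code (lut_plus c) = aplus (code c).
Proof.
by apply: code_class; have [e _] := codeP c; split.
Qed.

Lemma code_one : code (lut_one X) = ([set [::]], [::]).
Proof.
apply: code_class; split=> //=; rewrite eqEsubset; split=> w.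
  by move->; exists tt.
by case=> v; case: w => [|x w] //= [].
Qed.

Definition letter_code (x : X) : code_algebra X :=
  ([set [::]] `|` [set [:: x]], [:: (x, [set [::]])]).

Lemma code_letter x : code (lut_letter x) = letter_code x.
Proof.
have nil_lang : lang (letter_graph x) true = [set [::]].
  rewrite eqEsubset; split=> w; last by move->; exists true.
  by case=> v; case: w => [|y w] //= [].
apply: code_class; split=> /=; last by exists true.
rewrite eqEsubset; split=> w.
  by case=> ->; [exists false|exists true; exists true].
case=> v; case: w => [|y w] /= [t]; first by left.
case: t => // -[<-] tv; right; congr cons.
have : lang (letter_graph x) true w by exists v.
by rewrite nil_lang.
Qed.

End ClassCodes.

(** * Splayed trees *)

Section PathTrees.
Context (X : Type) (V : finType) (G : pgraph X V) (tG : is_left_tree G).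

Lemma path_graph_walk v (a : {u | on_path G v u}) w z :
  walk (lstep G) (val a) w z -> connect (arc G) z v ->
  exists2 z', val z' = z & walk (lstep (path_graph tG v)) a w z'.
Proof.
elim: w a => [|x w IH] a /=; first by move=> <- _; exists a.
case=> t at' tz zv.
have tv : on_path G v t by apply: connect_trans (walk_connect tz) zv.
have [z' <- tz'] := IH (exist _ t tv) tz zv; exists z' => //.
by exists (exist _ t tv).
Qed.

Lemma path_code v w : walk (lstep G) (start G) w v ->
  has_code (path_graph tG v) ([set u | exists u', w = u ++ u'], [::]).
Proof.
move=> sw; split=> //=; rewrite eqEsubset; split=> u.
  case=> u' e; move: sw; rewrite e => /walk_cat[t su tv].
  have [//|z _ su'] := path_graph_walk (v := v) (a := start (path_graph tG v)) su _.
    exact: walk_connect tv.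
  by exists z.
case=> z sz; have [u' zv] := connect_walk (valP z).
exists u'; apply: walk_word_uniq sw _; first exact: tG.
apply/walk_cat; exists (val z) => //.
exact: (walk_homo (f := val) _ sz).
Qed.

(** Induction from the last letter of [w]: a map for the path to the parent of [v] is redefined at
    [v], which has no outgoing edge on the path. *)
Lemma path_morphism (W : finType) (K : pgraph X W) a v w :
  walk (lstep G) (start G) w v -> lang K a w ->
  exists f, gmorphism (path_graph tG v) (PGraph (edge K) a a) f.
Proof.
move=> sw [b ab].
(* The map is sought on all of [V], so that its domain does not vary with [v]; its values off the
   path are arbitrary. *)
suff [f [fs _ fe]] : exists f : V -> W, [/\ f (start G) = a, f v = b &
    forall x u u', on_path G v u -> on_path G v u' -> lstep G x u u' ->
      lstep K x (f u) (f u')].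
  exists (f \o val); split=> // u u' x; apply: fe; exact: valP.
elim/last_ind: w v b sw ab => [|w x IH] v b.
  move=> /= <- <-; exists (fun=> a); split=> // x u u' us u's uu'.
  have [e|ne] := eqVneq u' (start G).
    by case: (lstep_start tG (x := x) (u := u)); rewrite -e.
  by have [t _ /(negP (left_tree_start t tG))] := connect_arc_last u's ne.
case/walk_rcons=> v' sv' v'v /walk_rcons[b' ab' b'b].
have [f [fs fv fe]] := IH _ _ sv' ab'.
have to_v' u : on_path G v u -> u != v -> on_path G v' u.
  move=> uv ne; have [t ut tv] := connect_arc_last uv ne.
  by rewrite (left_tree_parent tG (lstep_arc v'v) tv).
have nloop u u' : arc G u u' -> on_path G v u' -> u != v.
  move=> uu' u'v; apply/eqP => e; rewrite e in uu'.
  by move: (left_tree_acyclic tG uu'); rewrite [connect _ _ _]u'v.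
exists (fun u => if u == v then b else f u); split.
- case: eqP => // e; move: (left_tree_start v' tG).
  by rewrite e (lstep_arc v'v).
- by rewrite eqxx.
move=> y u u' uv u'v uu'.
rewrite (negbTE (nloop _ _ (lstep_arc uu') u'v)).
have nu := nloop _ _ (lstep_arc uu') u'v.
case: eqP => [e|/eqP ne]; last by apply: fe uu'; apply: to_v'.
rewrite e in uu'; have [-> ->] := lstep_det tG uu' v'v.
by rewrite fv.
Qed.

End PathTrees.

Section Splayed.
Context (X : Type).
Implicit Types c d : LUT1 X.

Lemma code_path c (v : 'I_(nvert (repr c))) w :
  walk (lstep (repr c)) (start (repr c)) w v ->
  code (lut_path v) = ([set u | exists u', w = u ++ u'], [::]).
Proof. by move=> sw; apply/code_class/path_code. Qed.

Lemma code_lutE (b : LUT1 X) : lutE X b -> code b = (lang (repr b) (start (repr b)), [::]).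
Proof.
by move=> e; apply: has_code_uniq (ltreeP _) (codeP b) _; split=> //=.
Qed.

(** Among the vertices reachable from [u], take one with the most ancestors; a successor would have
    more. *)
Lemma ex_leaf (V : finType) (G : pgraph X V) (u : V) : is_left_tree G ->
  exists2 v, is_leaf G v & connect (arc G) u v.
Proof.
move=> tG.
case: (arg_maxnP (P := connect (arc G) u)
  (fun x => #|[set z | connect (arc G) z x]%SET|) (connect0 _ u)) => v uv vmax.
exists v => //; apply/forallP => t; apply/negP => vt.
have := vmax t (connect_trans uv (connect1 vt)); rewrite /= leqNgt => /negP; apply.
apply: proper_card; apply/properP; split.
  by apply/fintype.subsetP => z; rewrite !inE => zv; apply: connect_trans (connect1 vt).
by exists t; rewrite inE ?connect0 ?(left_tree_acyclic tG).
Qed.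

(** Words of the path factors are words of [b]; conversely every word extends to one leading to a
    leaf, hence is a prefix read on a path factor. *)
Lemma code_splayE (b : LUT1 X) : lutE X b -> code (splayE b) = code b.
Proof.
move=> bE; rewrite (code_lutE bE).
set G := graph (repr b); have tG : is_left_tree G := ltreeP _.
suff [sub tl sup] : [/\ (code (splayE b)).1 `<=` lang G (start G),
    (code (splayE b)).2 = [::] & lang G (start G) `<=` (code (splayE b)).1].
  by case: (code _) sub tl sup => L s /= sub -> sup; congr pair; apply/seteqP.
have [sub tl] : (code (splayE b)).1 `<=` lang G (start G) /\
    (code (splayE b)).2 = [::].
  rewrite /splayE; elim/big_ind: _ => [|c d [sc tc] [sd td]|v _].
  - by rewrite code_one; split=> //= w ->; exists (start G).
  - rewrite code_mul /= tc td /= image_cat0; split=> // w [/sc|/sd] //.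
  have [w sw] := connect_walk (tG.2 v); rewrite (code_path sw); split=> //=.
  by move=> u [u' e]; move: sw; rewrite e => /walk_cat[t su _]; exists t.
split=> // u [z su]; have [v lv zv] := ex_leaf z tG.
have [u' zu'] := connect_walk zv.
have sv : walk (lstep G) (start G) (u ++ u') v by apply/walk_cat; exists z.
(* Emptiness of the trunk is carried through the induction: by [hd] it passes to the factors and
   makes the language of the product a plain union. *)
move: tl; rewrite /splayE; elim: (index_enum _) (mem_index_enum v) => // t r IH.
have hd (m n : code_algebra X) : (amul m n).2 = [::] ->
    m.2 = [::] /\ (n.2 = [::] /\ (amul m n).1 = m.1 `|` n.1).
  case: m n => [L [|[y N] s]] [L' s'] //= ->.
  by rewrite image_cat0.
rewrite inE big_cons => /orP[/eqP <-|/IH{}IH].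
  rewrite lv code_mul => /hd[_ [_ ->]]; left.
  by rewrite (code_path sv); exists u'.
case: ifP => // _; rewrite code_mul => /hd[_ [/IH ru ->]].
by right.
Qed.

(** A class containing all values of [splay], set up so that morphisms and generation can be
    obtained by induction on gluing. *)
Inductive splayed : LUT1 X -> Prop :=
| splayed_one : splayed (lut_one X)
| splayed_letter x : splayed (lut_letter x)
| splayed_path c (v : 'I_(nvert (repr c))) : splayed (lut_path v)
| splayed_mul c d : splayed c -> splayed d -> splayed (lut_mul c d).

Lemma splayed_splayE b : splayed (splayE b).
Proof.
rewrite /splayE; elim/big_ind: _ => [|c d|v _]; first exact: splayed_one.
  exact: splayed_mul.
exact: splayed_path.
Qed.

Lemma splayed_branch_product (B : Type) (f : B -> LUT1 X) b s : splayed b ->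
  splayed (branch_product b [seq (xb.1, splayE (f xb.2)) | xb <- s]).
Proof.
elim: s b => [|[x c] s IH] b //= sb; apply: IH.
apply: splayed_mul (splayed_splayE _); exact: splayed_mul (splayed_letter x).
Qed.

(** [fstep] and [fits] weaken [cstep] and [has_code] to what a morphism into [K] with ends [a] and
    [b] provides: inclusions of languages instead of equalities. *)
Definition fstep (W : finType) (K : pgraph X W) (y : X * set (seq X)) (u v : W) : Prop :=
  lstep K y.1 u v /\ y.2 `<=` lang K v.

Definition fits (W : finType) (K : pgraph X W) (a b : W) (m : code_algebra X) : Prop :=
  m.1 `<=` lang K a /\ walk (fstep K) a m.2 b.

Lemma has_code_fits (W : finType) (K : pgraph X W) m :
  has_code K m -> fits K (start K) (stop K) m.
Proof.
case: m => L s [/= -> Ks]; split=> //=.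
by apply: (walk_homo (f := id)) Ks => -[x N] a b [ab /= <-]; split.
Qed.

(** The vertex [t] is where the trunk of [m] ends in [K]; grafting has put the whole root language
    of [n] there. *)
Lemma fits_mul (W : finType) (K : pgraph X W) a b (m n : code_algebra X) :
  fits K a b (amul m n) -> exists t : W, fits K a t m /\ fits K t b n.
Proof.
case: m n => [L s] [L' s']; rewrite /fits /= subUset => -[[La sL']].
case/walk_cat=> c ac cb; exists c.
suff [] : walk (fstep K) a s c /\ L' `<=` lang K c by [].
elim: s a {La} sL' ac => [|[x N] s IH] a /= sL'.
  by rewrite image_cat0 in sL'; move=> <-.
case=> t [at']; rewrite /= subUset => -[Nt] /IH/[apply] -[tc L'c].
by split=> //; exists t.
Qed.

(* Branches of a splayed tree are bunches of paths, so they can be mapped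
   into any tree one path at a time; this fails for other trees. *)
Lemma splayed_morphism d (W : finType) (K : pgraph X W) a b : splayed d ->
  fits K a b (code d) -> exists f, gmorphism (repr d) (PGraph (edge K) a b) f.
Proof.
have via (V : finType) (G : pgraph X V) (tG : is_left_tree G) a' b' :
    (exists f, gmorphism G (PGraph (edge K) a' b') f) ->
    exists f, gmorphism (repr (iso_class tG)) (PGraph (edge K) a' b') f.
  have [g [g' [_ mg' _ _]]] := iso_class_repr tG.
  by case=> f mf; exists (f \o g'); apply: gmorphism_comp mf.
move=> sd; elim: sd a b => {d} [|x|c v|c d _ IHc _ IHd] a b.
- by rewrite code_one => -[_ /= <-]; apply: via; exists (fun=> a).
- rewrite code_letter => -[_ /= [t [/= at' _] <-]]; apply: via.
  exists (fun u : bool => if u then t else a); split=> //.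
  by move=> [] [] y //= [<-].
- have [w sw] := connect_walk ((ltreeP (repr c)).2 v).
  rewrite (code_path sw) => -[/= La <-]; apply: via; apply: path_morphism sw _.
  by apply: La; exists [::]; rewrite cats0.
rewrite code_mul => /fits_mul[t [/IHc[f [fs ft fe]] /IHd[g [gs gt ge]]]].
apply: via.
exists (fun u => match u with inl u => f u | inr u => g (val u) end).
split=> //=.
  have [[e ->]|[u e ->]] := glue_inrP (repr c) (repr d) (stop (repr d)).
    by rewrite ft -[b]gt e gs.
  by rewrite e gt.
case=> [u|u] [v|v] //= x; [exact: fe| |exact: ge].
by case: eqP => // -> /ge; rewrite gs ft.
Qed.

End Splayed.

(** * Pruned retracts *)

(** By the pigeonhole principle the powers of [f] are eventually periodic. *)
Lemma iter_idempotent (V : finType) (f : V -> V) :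
  exists n, forall v, iter n.+1 f (iter n.+1 f v) = iter n.+1 f v.
Proof.
have [a [d ad]] : exists a d, forall v, iter (d.+1 + a) f v = iter a f v.
  pose F (i : 'I_#|{ffun V -> V}|.+1) := [ffun v => iter i f v].
  have FE i j : F i = F j -> i < j ->
      exists a d, forall v, iter (d.+1 + a) f v = iter a f v.
    move=> eF ltij; exists i, (j - i).-1 => v.
    rewrite prednK ?subn_gt0 // subnK ?(ltnW ltij) //.
    by have /ffunP/(_ v) := eF; rewrite !ffunE.
  have /injectivePn[i [j ij eF]] : ~~ injectiveb F.
    by apply/injectiveP => /leq_card; rewrite card_ord ltnn.
  case: (ltngtP i j) ij => [lt _|lt _|/val_inj->]; last by rewrite eqxx.
    exact: FE eF lt.
  exact: FE (esym eF) lt.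
have shift q k v : a <= k -> iter (q * d.+1 + k) f v = iter k f v.
  move=> ak; elim: q => // q IH; rewrite -[RHS]IH mulSn -addnA.
  rewrite -(subnK (leq_trans ak (leq_addl (q * d.+1) k))).
  by rewrite addnCA iterD ad -iterD.
(* The exponent is [a.+1 * d.+1]: a multiple of the period [d.+1], and at least the preperiod
   [a]. *)
exists (d + a * d.+1)%N => v; rewrite -iterD -[_.+1]/(a.+1 * d.+1)%N shift //.
exact: leq_trans (leqnSn a) (leq_pmulr _ _).
Qed.

Section Cores.
Context (X : Type).

Lemma gmorphism_iter (V : finType) (G : pgraph X V) f n :
  gmorphism G G f -> gmorphism G G (iter n f).
Proof.
move=> mf; elim: n => [|n IH]; first exact: gmorphism_id.
exact: gmorphism_comp IH mf.
Qed.

(** An idempotent power of [h] is a retraction, hence the identity. *)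
Lemma pruned_endo (V : finType) (G : pgraph X V) h :
  is_pruned G -> gmorphism G G h -> exists n, forall v, iter n.+1 h v = v.
Proof.
move=> pG mh; have [n nn] := iter_idempotent h; exists n => v.
by apply: pG v; split=> //; apply: gmorphism_iter.
Qed.

(** Both composites have finite order, so [g] followed by a power of [g \o f] inverts [f]. *)
Lemma pruned_giso (V W : finType) (G : pgraph X V) (D : pgraph X W) f g :
  is_pruned G -> is_pruned D -> gmorphism G D f -> gmorphism D G g -> giso G D.
Proof.
move=> pG pD mf mg.
have mh := gmorphism_comp mf mg; have mk := gmorphism_comp mg mf.
have [n nh] := pruned_endo pG mh; have [m mK] := pruned_endo pD mk.
have fK v : iter n (g \o f) (g (f v)) = v by rewrite -[RHS]nh iterSr.
exists f, (iter n (g \o f) \o g); split=> //.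
  exact: gmorphism_comp mg (gmorphism_iter n mh).
by move=> w; rewrite -[w]mK /= fK.
Qed.

Lemma giso_pruned (V W : finType) (G : pgraph X V) (D : pgraph X W) :
  giso G D -> is_pruned G -> is_pruned D.
Proof.
case=> i [j [mi mj iK jK]] pG r [mr rr] w.
have : (j \o r \o i) (j w) = j w.
  apply: pG; split=> [|v]; last by rewrite /= jK rr.
  exact: gmorphism_comp (gmorphism_comp mi mr) mj.
by rewrite /= jK => /(can_inj jK).
Qed.

(** Take a retraction with the fewest fixed points: a nontrivial retraction of its image would
    compose with it to one with fewer. *)
Lemma pruned_retract_ex (V : finType) (G : pgraph X V) :
  exists f (rf : retraction G f), is_pruned (image_graph rf).
Proof.
pose P n := `[< exists2 f, retraction G f & #|[pred v | f v == v]| = n >].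
have exP : exists n, P n.
  exists #|[pred v : V | v == v]|; apply/asboolP.
  have rid : retraction G id by split=> //; exact: gmorphism_id.
  by exists (id : V -> V).
case: (ex_minnP exP) => n /asboolP[f rf fn] nmin; exists f, rf.
move=> g [mg gg] z; apply/eqP/negPn/negP => gz.
have [r [mr rE]] := retract_gmorphism rf.
pose h := val \o g \o r.
have fg u : f (val (g u)) = val (g u) by apply/eqP; apply: (valP (g u)).
have rK u : r (val u) = u by apply: val_inj; rewrite rE; apply/eqP/(valP u).
have rh : retraction G h.
  split=> [|v]; last by rewrite /h /= rK gg.
  exact: gmorphism_comp (gmorphism_comp mr mg) (val_gmorphism rf).
have : n <= #|[pred v | h v == v]| by apply: nmin; apply/asboolP; exists h.
rewrite -fn leqNgt => /negP; apply; apply: proper_card; apply/properP; split.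
  apply/fintype.subsetP => v; rewrite !inE => /eqP <-.
  by rewrite /h /= fg.
exists (val z); rewrite !inE; first exact: valP z.
by rewrite /h /= rK; apply: contra gz => /eqP/val_inj ->.
Qed.

(** The image of the edge into [v] is again an edge into [v], and parents are unique. Hence images
    of retractions are closed under parents. *)
Lemma retraction_parent (V : finType) (G : pgraph X V) f u v :
  is_left_tree G -> retraction G f -> f v = v -> arc G u v -> f u = u.
Proof.
move=> tG rf fv uv; apply: (left_tree_parent tG _ uv).
by rewrite -[X in arc _ _ X]fv; apply: gmorphism_arc rf.1 uv.
Qed.

Lemma induced_left_tree (V : finType) (G : pgraph X V) (A : pred V)
    (a b : {v | A v}) : is_left_tree G ->
  (forall u, A u -> ~~ arc G u (val a)) ->
  (forall v, A v -> v != val a -> exists2 u, A u & arc G u v) ->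
  is_left_tree (induced G a b).
Proof.
move=> tG na par; apply: arborescence_left_tree; first last.
- by move=> u u' w uw u'w; apply/val_inj/(left_tree_parent tG uw u'w).
- by case=> u Au; apply: na.
case=> v Av; have /connectP[p pp lp] := tG.2 v.
elim/last_ind: p v Av pp lp => [|p w IH] v Av.
  move=> _ /= ev; have [e|ne] := eqVneq v (val a).
    by rewrite (_ : exist _ v Av = a) //; apply: val_inj.
  have [u _] := par v Av ne; rewrite [in arc _ _ _]ev.
  by move/negP: (left_tree_start u tG).
rewrite rcons_path last_rcons => /andP[pp pw] ev; rewrite -ev in pw.
have [e|ne] := eqVneq v (val a).
  by rewrite (_ : exist _ v Av = a) //; apply: val_inj.
have [u Au uv] := par v Av ne.
apply: connect_trans (IH u Au pp (left_tree_parent tG uv pw)) _.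
exact: connect1.
Qed.

Lemma image_left_tree (V : finType) (G : pgraph X V) f (rf : retraction G f) :
  is_left_tree G -> is_left_tree (image_graph rf).
Proof.
move=> tG; apply: induced_left_tree => //= [u _|v /eqP fv ne].
  exact: left_tree_start.
have [u _ uv] := connect_arc_last (tG.2 v) (contra_neq esym ne).
by exists u => //; apply/eqP/(retraction_parent tG rf fv uv).
Qed.

Implicit Types c d : LUT1 X.

Lemma pruneP c : is_pruning c (prune c).
Proof.
apply: (@xgetPex _ c [set d | is_pruning c d]).
have [f [rf pf]] := pruned_retract_ex (repr c).
exists (iso_class (image_left_tree rf (ltreeP (repr c)))); split.
  exact: giso_pruned (iso_class_repr _) pf.
by exists f, rf; apply: iso_class_repr.
Qed.

Definition hom c d := exists f, gmorphism (repr c) (repr d) f.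

(** Composed with an inclusion and a retraction, a morphism of trees becomes one of their prunings.
    The case [c = d] is uniqueness of the pruning. *)
Lemma is_pruning_eq c d c' d' : is_pruning c c' -> is_pruning d d' ->
  hom c d -> hom d c -> c' = d'.
Proof.
have half a b a' b' : is_pruning a a' -> is_pruning b b' -> hom a b -> hom a' b'.
  case=> _ [f [rf [_ [i [_ mi _ _]]]]] [_ [g [rg [j [_ [mj _ _ _]]]]]] [h mh].
  have [r [mr _]] := retract_gmorphism rg.
  exists (j \o (r \o (h \o (val \o i)))).
  apply: gmorphism_comp mj; apply: gmorphism_comp mr; apply: gmorphism_comp mh.
  exact: gmorphism_comp mi (val_gmorphism rf).
move=> cc' dd' cd dc; have [f mf] := half _ _ _ _ cc' dd' cd.
have [g mg] := half _ _ _ _ dd' cc' dc.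
by apply: lut_eqP; apply: pruned_giso mf mg; [case: cc'|case: dd'].
Qed.

Lemma code_prune c : code (prune c) = code c.
Proof.
have [_ [f [rf iso]]] := pruneP c.
apply: has_code_uniq (codeP c); first exact: ltreeP.
apply: (image_graph_code (rf := rf)).
exact: giso_code (giso_sym iso) (codeP _).
Qed.

End Cores.

(** * Branch decompositions *)

Section Branches.
Context (X : Type).
Implicit Types c d : LUT1 X.

Lemma lutE_class (V : finType) (G : pgraph X V) (tG : is_left_tree G) :
  start G = stop G -> lutE X (iso_class tG).
Proof.
by case: (iso_class_repr tG) => f [_ [[es et _] _ _ _]] e; rewrite /lutE /= -es -et e.
Qed.

(** The last trunk edge is cut: [b] consists of the vertices reachable from the end vertex, [c'] of
    the others, ending at the parent [p] of the end vertex. *)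
Lemma last_branch c : start (repr c) <> stop (repr c) ->
  exists c' x b, [/\ c = lut_mul (lut_mul c' (lut_letter x)) b, lutE X b &
    nvert (repr c') < nvert (repr c)].
Proof.
set G := graph (repr c); have tG : is_left_tree G := ltreeP _ => /eqP nst.
have [p _ pstop] := connect_arc_last (tG.2 (stop G)) nst.
have [x px] := arc_lstep pstop.
pose B v := connect (arc G) (stop G) v; pose A v := ~~ B v.
have Bstop : B (stop G) by apply: connect0.
have B_arc u v : B u -> arc G u v -> B v.
  by move=> Bu uv; apply: connect_trans Bu (connect1 uv).
have B_stop u : B u -> ~~ arc G u (stop G).
  by move=> Bu; apply/negP => /(left_tree_acyclic tG); rewrite [connect _ _ _]Bu.
have B_par u v : B v -> v != stop G -> arc G u v -> B u.
  move=> Bv; rewrite eq_sym => ne uv; have [t Bt tv] := connect_arc_last Bv ne.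
  by rewrite (left_tree_parent tG uv tv).
have Astart : A (start G).
  apply/negP => Bs; have [t _] := connect_arc_last Bs (contra_neq esym nst).
  exact/negP/left_tree_start.
have Ap : A p by apply: contraL pstop => /B_stop.
pose G' := induced G (exist A _ Astart) (exist A _ Ap).
pose D := induced G (exist B _ Bstop) (exist B _ Bstop).
have tG' : is_left_tree G'.
  apply: induced_left_tree => //= [u _|v Av ne]; first exact: left_tree_start.
  have [u _ uv] := connect_arc_last (tG.2 v) (contra_neq esym ne).
  by exists u => //; apply: contra Av => /B_arc; apply.
have tD : is_left_tree D.
  apply: induced_left_tree => //= v Bv ne.
  have [u Bu uv] := connect_arc_last Bv (contra_neq esym ne).
  by exists u.
exists (iso_class tG'), x, (iso_class tD); split; first last.
- rewrite nvert_class card_sig -[nvert _ in X in _ < X]card_ord.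
  apply: proper_card; apply/properP; split; first exact: subset_predT.
  by exists (stop G) => //; rewrite inE /A negbK.
- exact: lutE_class.
rewrite /lut_letter !lut_mul_class -[LHS]iso_classK.
apply/iso_class_eq/giso_sym.
(* [K] is [G'] with the last trunk edge attached; the end of that edge goes to [stop G], the vertex
   shared with [D]. *)
set K := glue G' _; pose i (a : glue_vertex {v | A v} (letter_graph x)) :=
  match a with inl u => val u | inr _ => stop G end.
have tr (w : {b : bool | b != false}) : val w = true by case: w => -[].
have stopK w : stop K = inr w.
  rewrite /K /=; have [[//]|[w' _ ->]] := glue_inrP G' (letter_graph x) true.
  by congr inr; apply: val_inj; rewrite !tr.
have noarc u v : ~~ arc G u v -> edge G u v = None.
  by rewrite /arc; case: (edge G u v).
have AB u v : A u -> B v -> u <> v by move=> Au Bv e; rewrite e /A Bv in Au.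
apply: (glue_giso (i := i) (j := val)) => //=.
- case=> [u|w] [u'|w'] /=.
  + by move/val_inj->.
  + by move/(AB _ _ (valP u) Bstop).
  + by move/esym/(AB _ _ (valP u') Bstop).
  + by move=> _; congr inr; apply: val_inj; rewrite !tr.
- exact: val_inj.
- case=> [u|w] w' /=; first by move/(AB _ _ (valP u) (valP w')).
  by move=> e; apply: val_inj.
- by rewrite [glue_inr _ _ _](stopK (exist (fun b => b != false) true isT)).
- move=> u; case Bu: (B u); first by right; exists (exist _ u Bu).
  by left; exists (inl (exist _ u (negbT Bu))).
- case=> [u|w] [u'|w'] //=.
  + rewrite tr /=; case: eqP => [->|ne] //=.
    apply: noarc; apply/negP => ustop; case: ne; apply: val_inj.
    exact: left_tree_parent tG ustop pstop.
  + by apply: noarc; apply: contra (valP u') => /(B_arc _ _ Bstop).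
  + by rewrite !tr; apply/noarc/B_stop.
- case=> [u|w] w' /= nu nw'; last first.
    by case/eqP: nu; apply/esym/(stopK w).
  apply: noarc; apply: contra (valP u); apply: B_par (valP w') _.
  exact: nw'.
case=> [u|w] w' nw' /=; last by apply/noarc/B_stop/(valP w').
by apply: noarc; apply: contra (valP u) => /(B_arc _ _ (valP w')).
Qed.

Lemma branch_decomposition c : exists (b : lutE X) (s : seq (X * lutE X)),
  c = branch_product (val b) [seq (xb.1, val xb.2) | xb <- s].
Proof.
have [n] := ubnP (nvert (repr c)); elim: n c => // n IH c ltn.
have [e|ne] := pselect (start (repr c) = stop (repr c)).
  by exists (exist _ c (mem_set e)), [::].
have [c' [x [b [ec bE lt]]]] := last_branch ne.
have [b0 [s es]] := IH c' (leq_trans lt ltn).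
exists b0, (rcons s (x, exist _ b (mem_set bE))).
by rewrite ec es map_rcons /branch_product foldl_rcons.
Qed.

Lemma splayP c : is_splay c (splay c).
Proof.
apply: (@xgetPex _ c [set d | is_splay c d]).
have [b [s ec]] := branch_decomposition c.
by exists (branch_product (splayE (val b)) [seq (xb.1, splayE (val xb.2)) | xb <- s]), b, s.
Qed.

Lemma splayed_splay c : splayed (splay c).
Proof.
have [b [s [_ ->]]] := splayP c.
exact: splayed_branch_product (splayed_splayE _).
Qed.

Lemma code_splay c : code (splay c) = code c.
Proof.
have [b [s [-> ->]]] := splayP c.
have : code (splayE (val b)) = code (val b) by apply/code_splayE/set_mem/valP.
elim: s (val b) (splayE (val b)) => [|[x [d dE]] s IH] t t' //= e; apply: IH.
by rewrite !code_mul e (code_splayE (set_mem dE)).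
Qed.

Lemma code_hat c : code (hat c) = code c.
Proof. by rewrite /hat code_prune code_splay. Qed.

Lemma splayed_hom c d : splayed c -> code c = code d -> hom c d.
Proof.
move=> sc e; have [|f mf] := splayed_morphism (K := repr d) (a := start (repr d))
    (b := stop (repr d)) sc.
  by rewrite e; apply: has_code_fits (codeP d).
by exists f; case: mf.
Qed.

Lemma hat_eq c d : code c = code d -> hat c = hat d.
Proof.
move=> e; apply: is_pruning_eq (pruneP _) (pruneP _) _ _;
  by apply: splayed_hom (splayed_splay _) _; rewrite !code_splay.
Qed.

(** [c] is its own pruning, and [c] and [splay c] are splayed with the same code, hence
    homomorphically equivalent. *)
Lemma hat_splayed_pruned c : splayed c -> is_pruned (repr c) -> hat c = c.
Proof.
move=> sc pc; apply: (@is_pruning_eq _ (splay c) c); first exact: pruneP.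
- split=> //; have rid : retraction (repr c) id by split=> //; apply: gmorphism_id.
  exists id, rid; apply: (giso_bij (f := val)) => //; first exact: val_inj.
  by move=> v; exists (exist _ v (eqxx v)).
- by apply: splayed_hom (splayed_splay _) _; rewrite code_splay.
by apply: splayed_hom; rewrite ?code_splay.
Qed.

Lemma hat_letter (x : X) : hat (lut_letter x) = lut_letter x.
Proof.
apply: hat_splayed_pruned; first exact: splayed_letter.
apply: giso_pruned (iso_class_repr _) _ => f [[fs ft _] _] [].
  exact: ft.
exact: fs.
Qed.

Lemma hat_one : hat (lut_one X) = lut_one X.
Proof.
apply: hat_splayed_pruned; first exact: splayed_one.
by apply: giso_pruned (iso_class_repr _) _ => f _ []; case: (f tt).
Qed.

End Branches.

(** * Evaluation of codes in a left h-Ehresmann semigroup *)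

Local Notation "x ** y" := (amul x y) (at level 40, left associativity).

Section LeftHEhresmann.
Context (T : algebra21) (hT : left_h_Ehresmann T).
Implicit Types x y z a b c : T.

Lemma mulA x y z : x ** (y ** z) = x ** y ** z.
Proof. by case: hT => -[]. Qed.

Lemma plus_mul_id x : aplus x ** x = x.
Proof. by case: hT => -[]. Qed.

Lemma plus_mul_plus x y : aplus (aplus x ** aplus y) = aplus x ** aplus y.
Proof. by case: hT => -[]. Qed.

Lemma plusC x y : aplus x ** aplus y = aplus y ** aplus x.
Proof. by case: hT => -[]. Qed.

Lemma plus_mulr x y : aplus (x ** aplus y) = aplus (x ** y).
Proof. by case: hT => -[]. Qed.

Lemma plus_h x y z :
  aplus (x ** aplus z ** y) = aplus (x ** y) ** aplus (x ** z).
Proof. by case: hT. Qed.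

Lemma plus_idem x : aplus x ** aplus x = aplus x.
Proof. by rewrite -plus_mul_plus plus_mulr plus_mul_id. Qed.

Lemma plusK x : aplus (aplus x) = aplus x.
Proof. by rewrite -{1}(plus_idem x) plus_mul_plus plus_idem. Qed.

Lemma plus_mull x y : aplus (aplus x ** y) = aplus x ** aplus y.
Proof. by rewrite -plus_mulr plus_mul_plus. Qed.

Lemma plus_prefix x y : aplus x ** aplus (x ** y) = aplus (x ** y).
Proof. by rewrite -plus_mull mulA plus_mul_id. Qed.

(** For a projection [b], this is the natural order between [aplus a] and [b]. *)
Definition below a b : Prop := aplus a ** b = aplus a.

Lemma below_mul a b c :
  below a (aplus b ** aplus c) <-> below a (aplus b) /\ below a (aplus c).
Proof.
rewrite /below; split=> [e|[eb ec]]; last by rewrite mulA eb.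
split; rewrite -{1}e -!mulA; last by rewrite plus_idem e.
by rewrite (plusC c) (mulA (aplus b)) plus_idem e.
Qed.

End LeftHEhresmann.

(** [None] is the adjoined identity and its own projection; it serves as the value of the empty
    word. *)
Definition with_one (S : algebra21) : algebra21 := @Algebra21 (option S)
  (fun x y => match x, y with
    | Some a, Some b => Some (a ** b) | None, _ => y | _, None => x end)
  (omap (@aplus S)).

Lemma with_one_left_h_Ehresmann (S : algebra21) :
  left_h_Ehresmann S -> left_h_Ehresmann (with_one S).
Proof.
move=> hS; split; first split.
- by move=> [x|] [y|] [z|] //=; rewrite (mulA hS).
- by move=> [x|] //=; rewrite (plus_mul_id hS).
- by move=> [x|] [y|] //=; rewrite ?(plus_mul_plus hS) ?(plusK hS).
- by move=> [x|] [y|] //=; rewrite (plusC hS).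
- by move=> [x|] [y|] //=; rewrite ?(plus_mulr hS) ?(plusK hS).
move=> [x|] [y|] [z|] //=.
- by rewrite (plus_h hS).
- by rewrite (plusC hS) (plus_prefix hS).
- by rewrite (plus_mulr hS) (plus_prefix hS).
- by rewrite (plus_idem hS).
- by rewrite (plus_mull hS) (plusC hS).
- by rewrite (plusK hS).
Qed.

Section Evaluation.
Context (T : algebra21) (hT : left_h_Ehresmann T) (one : T).
Context (mul1 : forall x : T, one ** x = x) (mulr1 : forall x : T, x ** one = x).
Context (plus1 : aplus one = one).
Context (X : Type) (F : X -> T).
Implicit Types (L N : set (seq X)) (s : seq (X * set (seq X))) (t u : T).

Definition eval_word (w : seq X) : T := foldr (fun x t => F x ** t) one w.

(* The projection of [e] is the meet of the projections of the words of [L],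
   which may be infinite, and this meet persists after left multiplication. *)
Definition is_meet L (e : T) : Prop := forall y a : T,
  below a (aplus (y ** e)) <->
  forall w, L w -> below a (aplus (y ** eval_word w)).

(** A relation and not a function, since meets over infinite languages need not exist in [T]. The
    equations put [t] in the form e_0 x_1 e_1 ... x_k e_k, with [aplus t] as e_0. *)
Fixpoint evals L s t : Prop :=
  is_meet L t /\
  if s is (x, N) :: r then exists2 u, evals N r u & t = aplus t ** (F x ** u)
  else t = aplus t.

Lemma evals_meet L s t : evals L s t -> is_meet L t.
Proof. by case: s => [|[x N] r] []. Qed.

Lemma is_meet_plus L t : is_meet L t -> is_meet L (aplus t).
Proof. by move=> Lt y a; rewrite (plus_mulr hT); apply: Lt. Qed.

(** Testing with [y := one] puts each projection below the other. *)
Lemma is_meet_uniq L t t' : is_meet L t -> is_meet L t' -> aplus t = aplus t'.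
Proof.
have le u v : is_meet L u -> is_meet L v -> aplus u ** aplus v = aplus u.
  move=> Lu Lv; have /Lu : below u (aplus (one ** u)).
    by rewrite mul1 /below (plus_idem hT).
  by move/Lv; rewrite mul1.
by move=> Lt Lt'; rewrite -(le _ _ Lt Lt') (plusC hT) le.
Qed.

Lemma evals_uniq L s t t' : evals L s t -> evals L s t' -> t = t'.
Proof.
elim: s L t t' => [|[x N] r IH] L t t' /= [Lt et] [Lt' et'].
  by rewrite et et'; apply: is_meet_uniq Lt Lt'.
case: et et' => u ru -> [u' ru' ->]; rewrite (IH _ _ _ ru ru').
by rewrite (is_meet_uniq Lt Lt').
Qed.

Lemma is_meet_mul L s t L' t' : evals L s t -> is_meet L' t' ->
  is_meet (L `|` cat (word s) @` L') (t ** t').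
Proof.
move=> + Lt'; elim: s L t => [|[x N] r IH] L t /= [Lt et] y a.
  rewrite image_cat0 et (mulA hT) (plus_h hT) (below_mul hT) (Lt y) (Lt' y).
  by split=> [[l' l] w [/l|/l']|l] //; split=> w Lw; apply: l; [right|left].
case: et => u ru et; rewrite et -2!(mulA hT) [y ** _](mulA hT) (plus_h hT).
rewrite (below_mul hT) (mulA hT y) (IH _ _ ru).
split=> [[l1 l2] w [Lw|[v L'v <-]]|l].
- by move/(Lt y a): l2; apply.
- by rewrite /= (mulA hT y); apply: l1; right; exists v.
have lt : below a (aplus (y ** t)) by apply/(Lt y a) => w Lw; apply: l; left.
split=> // w [Nw|[v L'v <-]]; last first.
  by rewrite -(mulA hT); apply: (l (x :: _)); right; exists v.
(* The words [x :: w] with [w] in [N] are not among those assumed; they are covered because [t] has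
   [F x ** u] as a factor, so the projection of [y ** t] is below that of [y ** (F x ** u)]. *)
move: lt; rewrite {1}et (mulA hT y) (plus_h hT) (below_mul hT) (mulA hT y).
by case=> /(evals_meet ru) l1 _; apply: l1.
Qed.

(** With [z := F x ** (u ** t')], the product is [aplus t ** z], with projection
    [aplus t ** aplus z]; its normal form then follows from [aplus z ** z = z]. *)
Lemma evals_mul L s t L' s' t' : evals L s t -> evals L' s' t' ->
  evals (L `|` cat (word s) @` L') (graft s L' ++ s') (t ** t').
Proof.
move=> + et'; have Lt' := evals_meet et'.
elim: s L t => [|[x N] r IH] L t et; have := is_meet_mul et Lt'.
  move: et => /= [_ et]; case: s' et' => [|[x N] r] /= [_].
    by move=> et'; split=> //; rewrite et et' (plus_mul_plus hT).
  case=> u ru et'; split=> //; exists u => //.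
  by rewrite et (plus_mull hT) -(mulA hT) -et'.
move: et => /= [_ [u ru et]]; split=> //; exists (u ** t'); first exact: IH.
rewrite {1 2}et -(mulA hT) (plus_mull hT) -!(mulA hT) (mulA hT (F x)).
by rewrite (plus_mul_id hT).
Qed.

Lemma evals_plus L s t : evals L s t -> evals L [::] (aplus t).
Proof.
by move/evals_meet/is_meet_plus => Lt; split=> //; rewrite (plusK hT).
Qed.

Lemma evals_letter x :
  evals (letter_code x).1 (letter_code x).2 (F x).
Proof.
split=> [y a|/=].
  split=> [l w [->|->] /=|l]; rewrite ?mulr1 //.
    (* The empty word adds no condition: the projection of [y ** F x] is below that of [y]. *)
    by move: l; rewrite -(plus_prefix hT) (below_mul hT) => -[].
  by have := l [:: x] (or_intror erefl); rewrite /= mulr1.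
exists one; last by rewrite mulr1 (plus_mul_id hT).
by split=> // y a; split=> [l w ->|l] //; apply: (l [::]).
Qed.

End Evaluation.

Inductive generated (A : algebra21) (Y : Type) (i : Y -> A) : A -> Prop :=
| generated_base y : generated i (i y)
| generated_mul a b : generated i a -> generated i b -> generated i (a ** b)
| generated_plus a : generated i a -> generated i (aplus a).

Lemma generated_morphism_eq (A S : algebra21) (Y : Type) (i : Y -> A)
    (g h : A -> S) :
  (forall a, generated i a) -> morphism21 g -> morphism21 h ->
  (forall y, g (i y) = h (i y)) -> g = h.
Proof.
move=> gen [gM gP] [hM hP] e; apply/funext => a.
by elim: (gen a) => [//|b c _ eb _ ec|b _ eb]; rewrite ?gM ?hM ?gP ?hP ?eb ?ec.
Qed.

Lemma injective_left_h_Ehresmann (A B : algebra21) (f : A -> B) :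
  injective f -> morphism21 f -> left_h_Ehresmann B -> left_h_Ehresmann A.
Proof.
move=> fI [fM fP] hB; split; first split; move=> *; apply: fI;
  rewrite ?(fM, fP).
- exact: mulA.
- exact: plus_mul_id.
- exact: plus_mul_plus.
- exact: plusC.
- by rewrite plus_mulr.
- exact: plus_h.
Qed.

(** * Freeness *)

Section Freeness.
Context (X : Type).

Definition H_code (c : H_pos_algebra X) : code_algebra X := code (val c).

Lemma H_code_inj : injective H_code.
Proof.
move=> c d e; apply: val_inj.
have [[c' _ ec] _] := set_mem (valP c); have [[d' _ ed] _] := set_mem (valP d).
by rewrite -ec -ed; apply: hat_eq; rewrite -code_hat ec -(code_hat d') ed.
Qed.

Lemma H_code_morphism : morphism21 H_code.
Proof.
by split=> [c d|c]; rewrite /H_code /= code_hat ?code_mul ?code_plus.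
Qed.

Lemma letter_H_pos (x : X) : lut_letter x \in H_pos X.
Proof.
by rewrite -hat_letter; apply/H_pos_hat/eqP; rewrite -nontrivP nontriv_letter.
Qed.

Definition H_letter (x : X) : H_pos_algebra X :=
  exist (fun c => c \in H_pos X) (lut_letter x) (letter_H_pos x).

(** The first alternative is for the code of the trivial tree, which no element of [H_pos] has. *)
Definition spanned (d : LUT1 X) : Prop :=
  code d = code (lut_one X) \/ exists2 c, generated H_letter c & H_code c = code d.

Lemma spanned_mul c d : spanned c -> spanned d -> spanned (lut_mul c d).
Proof.
case=> [ec|[c' gc ec]].
  by rewrite /spanned code_mul ec -code_mul lut_mul1l.
case=> [ed|[d' gd ed]]; right.
  by exists c'; rewrite // code_mul ed -code_mul lut_mulr1.
exists (c' ** d'); first exact: generated_mul.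
by rewrite H_code_morphism.1 code_mul ec ed.
Qed.

Lemma spanned_plus c : spanned c -> spanned (lut_plus c).
Proof.
rewrite /spanned code_plus; case=> [->|[c' gc ec]]; first by rewrite code_one; left.
right; exists (aplus c'); first exact: generated_plus.
by rewrite H_code_morphism.2 ec.
Qed.

(** [d] is the product of the letters of [w]. Its root language is that of a path tree, so
    [lut_plus d] has the code of that path tree. *)
Lemma spanned_word (w : seq X) : exists2 d, spanned d &
  (code d).1 = [set u | exists v, w = u ++ v].
Proof.
elim: w => [|x w [d sd ed]].
  exists (lut_one X); first by left.
  rewrite code_one eqEsubset; split=> u; first by move=> /= ->; exists [::].
  by case=> v; case: u.
exists (lut_mul (lut_letter x) d).
  apply: spanned_mul sd; right; exists (H_letter x) => //.
  exact: generated_base.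
rewrite code_mul code_letter /= ed eqEsubset; split=> u.
  case=> [[->|->]|[u' [v ->] <-]]; [by exists (x :: w)|by exists w|by exists v].
case=> v; case: u => [|y u] /=; first by left; left.
by case=> <- ->; right; exists u => //; exists v.
Qed.

Lemma spanned_splayed d : splayed d -> spanned d.
Proof.
elim=> {d} [|x|c v|c d _ sc _ sd]; [by left| | |exact: spanned_mul].
  by right; exists (H_letter x) => //; apply: generated_base.
have [w sw] := connect_walk ((ltreeP (repr c)).2 v).
have [d /spanned_plus + e] := spanned_word w.
by rewrite /spanned code_plus (code_path sw) /= e.
Qed.

(** [val c] has the code of its splayed form, and codes separate the elements of H(X); the trivial
    code would force [c] to be the removed element. *)
Lemma H_generated (c : H_pos_algebra X) : generated H_letter c.
Proof.
have [|[c' gc]] := spanned_splayed (splayed_splay (val c)); rewrite code_splay.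
  move=> e; case: (H_pos_neq1 (c := c)); rewrite -hat_one -(hat_eq e).
  have [[d _ ed] _] := set_mem (valP c); rewrite -ed.
  by apply: hat_eq; rewrite code_hat.
by move/H_code_inj <-.
Qed.

Lemma H_pos_free : free_left_h_Ehresmann H_letter.
Proof.
split.
- exact: injective_left_h_Ehresmann H_code_inj H_code_morphism
    (@code_left_h_Ehresmann X).
- move=> x y e; have := congr1 H_code e.
  by rewrite /H_code /= !code_letter => -[_ ->].
move=> S hS f; have hS1 := with_one_left_h_Ehresmann hS.
(* [E] is the graph of the required morphism. Its values are of the form [Some t], so they stay in
   [S]; totality comes by induction over the generators, single-valuedness from [evals_uniq]. *)
pose E (c : H_pos_algebra X) (t : S) := evals (T := with_one S) None
  (fun x => Some (f x)) (H_code c).1 (H_code c).2 (Some t).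
have n1 (t : with_one S) : (None : with_one S) ** t = t by case: t.
have n2 (t : with_one S) : t ** (None : with_one S) = t by case: t.
have E_letter x : E (H_letter x) (f x).
  by rewrite /E /H_code code_letter; apply: evals_letter.
have E_mul c d t u : E c t -> E d u -> E (c ** d) (t ** u).
  by rewrite /E H_code_morphism.1; apply: evals_mul.
have E_plus c t : E c t -> E (aplus c) (aplus t).
  by rewrite /E H_code_morphism.2; apply: evals_plus.
have E_uniq c t u : E c t -> E c u -> t = u.
  by move=> ct cu; have [] := evals_uniq hS1 n1 ct cu.
have E_ex c : exists t, E c t.
  elim: (H_generated c) => [x|a b _ [t at'] _ [u bu]|a _ [t at']].
  - by exists (f x).
  - by exists (t ** u); apply: E_mul.
  - by exists (aplus t); apply: E_plus.
pose g c := projT1 (cid (E_ex c)).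
have gE c : E c (g c) by rewrite /g; case: cid.
have gM : morphism21 g by split=> *; apply: E_uniq (gE _) _; auto.
have gf x : g (H_letter x) = f x by apply: E_uniq (gE _) _.
exists g; split=> // h [hM hf].
by apply: generated_morphism_eq H_generated gM hM _ => x; rewrite gf hf.
Qed.

End Freeness.

Theorem corollary5p2 (X : Type) (hX : inhabited X) :
  exists iota : X -> H_pos_algebra X,
    (forall x : X, sval (iota x) = lut_letter x) /\
    free_left_h_Ehresmann iota.
Proof. by exists (@H_letter X); split=> //; apply: H_pos_free. Qed.
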